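(* Let $d\ge 2$. The families of functions $\{m_{n,d}: n\in\mathbb{N}_0\}$ and $\{h_{n,d}: n\in\mathbb{N}_0\}$ are biorthogonal; more precisely, $$\int_{-1}^1 m_{n,d}(u)\,h_{n',d}(u)\,du=\delta_{n,n'},\qquad n,n'\in\mathbb{N}_0.$$
   Context: $\mathbb{N}_0=\{0,1,2,\dots\}$ and $\mathbb{T}^d=(\mathbb{R}/2\pi\mathbb{Z})^d$. For $\alpha\in\mathbb{Z}^d$, $|\alpha|=|\alpha_1|+\cdots+|\alpha_d|$. Divided differences: for pairwise distinct real knots, $[x_0]f=f(x_0)$ and $[x_0,\ldots,x_m]f=\frac{[x_0,\ldots,x_{m-1}]f-[x_1,\ldots,x_m]f}{x_0-x_m}$; they are symmetric in the knots. B-spline: for $m\ge1$ and pairwise distinct $x_0,\ldots,x_m$, $M_m(u|x_0,\ldots,x_m)=[x_0,\ldots,x_m]\left\{\frac{(\cdot-u)_+^{m-1}}{(m-1)!}\right\}$, where $(x)_+^{k}=x^k$ if $x>0$ and $0$ otherwise. Thus $\theta\mapsto M_{d-1}(u|\cos\theta_1,\ldots,\cos\theta_d)$ is defined for almost every $\theta\in\mathbb{T}^d$. $E_n(\theta)=\sum_{\alpha\in\mathbb{Z}^d,\,|\alpha|=n}e^{i\alpha\cdot\theta}$, and $N_d(n)=\#\{\alpha\in\mathbb{Z}^d:|\alpha|=n\}=E_n(0)$. $m_{n,d}(u):=\frac{1}{(2\pi)^d}\int_{\mathbb{T}^d}M_{d-1}(u|\cos\theta_1,\ldots,\cos\theta_d)\,\frac{E_n(\theta)}{N_d(n)}\,d\theta$.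 $C_n^\lambda$ is the Gegenbauer polynomial of degree $n$ normalized by $C_n^\lambda(1)=(2\lambda)_n/n!$ (with $(a)_n=a(a+1)\cdots(a+n-1)$), i.e. with generating function $(1-2rt+r^2)^{-\lambda}=\sum_{n\ge0}C_n^\lambda(t)r^n$; $C_n^\lambda=0$ for $n<0$. The polynomial $h_{n,d}$ is $$h_{n,d}(u)=(d-1)!\sum_{j=0}^d(-1)^j\binom{d}{j}C_{n-2j}^d(u).$$ *)

(* Defs.v *)
From HB Require Import structures.
From mathcomp Require Import all_boot all_order all_algebra.
From mathcomp Require Import all_classical all_reals all_analysis.
From mathcomp Require Import finmap complex.

Set Implicit Arguments.
Unset Strict Implicit.
Unset Printing Implicit Defensive.

Import Order.TTheory GRing.Theory Num.Theory.
Import numFieldNormedType.Exports.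

Local Open Scope classical_set_scope.
Local Open Scope ring_scope.

Section lebesgue_tuple_succ.
Context (R : realType) (n : nat)
  (nu : {sigma_finite_measure set (n.-tuple R) -> \bar R}).
Local Open Scope ereal_scope.

Definition cons_pair (p : R * n.-tuple R) : n.+1.-tuple R :=
  [tuple of p.1 :: p.2].

Lemma measurable_cons_pair : measurable_fun [set: R * n.-tuple R] cons_pair.
Proof. by apply: measurable_cons; [exact: measurable_fst|exact: measurable_snd]. Qed.

Definition lebesgue_tupleS : set (n.+1.-tuple R) -> \bar R :=
  pushforward (@lebesgue_measure R \x nu) cons_pair.

Let lebesgue_tupleS0 : lebesgue_tupleS set0 = 0.
Proof. by rewrite /lebesgue_tupleS /pushforward preimage_set0 measure0. Qed.

Let lebesgue_tupleS_ge0 A : 0 <= lebesgue_tupleS A.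
Proof. by rewrite /lebesgue_tupleS /pushforward. Qed.

Let lebesgue_tupleS_sigma_additive : semi_sigma_additive lebesgue_tupleS.
Proof.
have mf := measurable_cons_pair.
move=> F mF tF mUF; rewrite /lebesgue_tupleS /pushforward preimage_bigcup.
apply: measure_semi_sigma_additive.
- by move=> k; rewrite -[X in measurable X]setTI; exact: mf.
- apply/trivIsetP => /= i j _ _ ij; rewrite -preimage_setI.
  by move/trivIsetP : tF => /(_ _ _ _ _ ij) ->//; rewrite preimage_set0.
- by rewrite -preimage_bigcup -[X in measurable X]setTI; exact: mf.
Qed.

HB.instance Definition _ := isMeasure.Build _ _ _ lebesgue_tupleS
  lebesgue_tupleS0 lebesgue_tupleS_ge0 lebesgue_tupleS_sigma_additive.

Let lebesgue_tupleS_sigma_finite : sigma_finite setT lebesgue_tupleS.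
Proof.
have /sigma_finiteP[F [TF ndF Foo]] := sigma_finiteT (@lebesgue_measure R).
have /sigma_finiteP[G [TG ndG Goo]] := sigma_finiteT nu.
pose g (t : n.+1.-tuple R) := (thead t, [tuple of behead t]) : R * n.-tuple R.
have mg : measurable_fun setT g.
  by apply/measurable_fun_pair; [exact: measurable_tnth|exact: measurable_behead].
have gK (p : R * n.-tuple R) : g (cons_pair p) = p.
  by case: p => x t; rewrite /g /cons_pair theadE; congr pair; exact/val_inj.
exists (fun k => g @^-1` (F k `*` G k)).
  rewrite -preimage_bigcup (_ : \bigcup_k (F k `*` G k) = setT) ?preimage_setT//.
  apply/seteqP; split => // -[x t] _.
  have [i _ Fi] : (\bigcup_i F i) x by rewrite -TF.
  have [j _ Gj] : (\bigcup_j G j) t by rewrite -TG.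
  exists (maxn i j) => //; split.
    by move: x Fi; exact/subsetPset/ndF/leq_maxl.
  by move: t Gj; exact/subsetPset/ndG/leq_maxr.
move=> k; have [mFk Fk] := Foo k; have [mGk Gk] := Goo k.
have mFG : measurable (F k `*` G k) by exact: measurableX.
split; first by rewrite -[X in measurable X]setTI; exact: mg.
rewrite /lebesgue_tupleS /pushforward.
rewrite (_ : cons_pair @^-1` (g @^-1` (F k `*` G k)) = F k `*` G k); last first.
  by rewrite -comp_preimage (_ : g \o cons_pair = id) ?preimage_id//; exact/funext.
by rewrite product_measure1E// lte_mul_pinfty// ge0_fin_numE.
Qed.

HB.instance Definition _ := Measure_isSigmaFinite.Build _ _ _ lebesgue_tupleS
  lebesgue_tupleS_sigma_finite.

End lebesgue_tuple_succ.

Fixpoint lebesgue_tuple (R : realType) (n : nat) :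
    {sigma_finite_measure set (n.-tuple R) -> \bar R} :=
  if n is n'.+1 then lebesgue_tupleS (lebesgue_tuple R n')
  else @dirac _ (0.-tuple R) [tuple] R.

Lemma lebesgue_tuple_box (R : realType) (n : nat) (A : 'I_n -> set R) :
  (forall i, measurable (A i)) ->
  lebesgue_tuple R n [set t | forall i, A i (tnth t i)] =
  (\prod_(i < n) lebesgue_measure (A i))%E.
Proof.
elim: n => [|n IH] in A *.
  move=> _; rewrite big_ord0 /= diracE mem_set//=.
  by case.
move=> mA; rewrite big_ord_recl /= /lebesgue_tupleS /pushforward.
set B := [set t : n.-tuple R | forall i, A (lift ord0 i) (tnth t i)].
have mB : measurable B.
  rewrite (_ : B = \bigcap_i (fun t : n.-tuple R => tnth t i) @^-1` A (lift ord0 i)).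
    apply: fin_bigcap_measurable => [|i _]; first exact: finite_finset.
    by rewrite -[X in measurable X]setTI; apply: (@measurable_tnth _ _ n i).
  by apply/seteqP; split => t /= h i; [move=> _; exact: h|exact: (h i)].
rewrite -IH // -product_measure1E //; last exact: mA.
congr (_ _).
apply/seteqP; split => [[x t] /= h|[x t] /= [hx ht] i].
  by split; [exact: (h ord0)|move=> i; have := h (lift ord0 i); rewrite tnthS].
by case: (unliftP ord0 i) => [j ->|->//]; rewrite tnthS; exact: ht.
Qed.

Local Open Scope complex_scope.

Section complex_integral.
Context d (T : measurableType d) (R : realType)
  (mu : {measure set T -> \bar R}) (D : set T) (f : T -> R[i]).

Definition Cintegrable : Prop :=
  mu.-integrable D (fun x => (complex.Re (f x))%:E) /\
  mu.-integrable D (fun x => (complex.Im (f x))%:E).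

Definition Cintegral : R[i] :=
  \int[mu]_(x in D) complex.Re (f x) +i* \int[mu]_(x in D) complex.Im (f x).

End complex_integral.

Definition cexpi (R : realType) (x : R) : R[i] := cos x +i* sin x.

(* The divided difference [x_0, ..., x_m] f. When two knots coincide the value
   is junk (division by zero yields 0). *)
Fixpoint divdiff (R : realType) (f : R -> R) (m : nat) (x : nat -> R) : R :=
  if m is m'.+1 then
    (divdiff f m' x - divdiff f m' (fun i => x i.+1)) / (x 0%N - x m)
  else f (x 0%N).

(* (x)_+^k with the convention (x)_+^0 = 0 for x <= 0. *)
Definition truncpow (R : realType) (k : nat) (x : R) : R :=
  if 0 < x then x ^+ k else 0.

(* M_m(u | x_0, ..., x_m), for m >= 1. *)
Definition Bspline (R : realType) (m : nat) (u : R) (x : nat -> R) : R :=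
  divdiff (fun y => truncpow m.-1 (y - u) / (m.-1)`!%:R) m x.

Definition l1sphere (d n : nat) : set {ffun 'I_d -> int} :=
  [set a | (\sum_(i < d) `|a i|)%N = n].

Lemma finite_l1sphere (d n : nat) : finite_set (@l1sphere d n).
Proof.
pose g (b : {ffun 'I_d -> 'I_n.+1 * bool}) : {ffun 'I_d -> int} :=
  [ffun i => (-1) ^+ (b i).2 * (b i).1%:Z].
apply: (@sub_finite_set _ _ (g @` setT)); last exact/finite_image/finite_finset.
move=> a /= an; exists [ffun i => (inord `|a i|%N, (a i < 0)%R)] => //.
apply/ffunP => i; rewrite !ffunE /= inordK -?intEsign// ltnS -an.
by rewrite (bigD1 i) //= leq_addr.
Qed.

Definition Ndn (d n : nat) : nat := #|` fset_set (@l1sphere d n)|%fset.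

Definition Edn (R : realType) (d n : nat) (theta : d.-tuple R) : R[i] :=
  \sum_(a \in @l1sphere d n) cexpi (\sum_(i < d) (a i)%:~R * tnth theta i).

(* A fundamental domain of T^d. *)
Definition torus_box (R : realType) (d : nat) : set (d.-tuple R) :=
  [set theta | forall i, tnth theta i \in `[0, 2 * pi]].

Definition mdn_integrand (R : realType) (d n : nat) (u : R)
    (theta : d.-tuple R) : R[i] :=
  (Bspline d.-1 u (fun i => cos (nth 0 theta i)))%:C *
  (Edn n theta / (Ndn d n)%:R).

Definition mdn (R : realType) (d n : nat) (u : R) : R[i] :=
  ((2 * pi) ^- d)%:C *
  Cintegral (lebesgue_tuple R d) (@torus_box R d) (mdn_integrand n u).

Definition pochhammer (R : realType) (a : R) (k : nat) : R :=
  \prod_(i < k) (a + i%:R).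

(* The polynomial in the outer variable r over {poly R} (variable t) is the
   truncated binomial series
     (1 - y)^-lambda = \sum_k (lambda)_k / k! y^k,  y = 2rt - r^2;
   since r divides y, the terms k > n do not contribute to r^n. *)
Definition gegenbauer_nat (R : realType) (lambda : R) (n : nat) : {poly R} :=
  (\sum_(k < n.+1) (pochhammer lambda k / k`!%:R)%:P *:
     (('X *+ 2)%:P * 'X - 'X^2 : {poly {poly R}}) ^+ k)`_n.

Definition gegenbauer (R : realType) (lambda : R) (n : int) : {poly R} :=
  if n is Posz n' then gegenbauer_nat lambda n' else 0.

Definition hdn (R : realType) (d n : nat) : {poly R} :=
  (d.-1)`!%:R *:
  \sum_(j < d.+1) ((-1) ^+ j * 'C(d, j)%:R) *: gegenbauer d%:R (n%:Z - (2 * j)%:Z).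

(* Main.v *)
Require Import Defs.
From mathcomp Require Import all_boot all_order all_algebra.
From mathcomp Require Import all_classical all_reals all_analysis.
From mathcomp Require Import complex.
From mathcomp Require Import measurable_realfun finmap ring lra zify.

(** Let [H] be a polynomial with [H^`(d.-1) = hdn R d n'] ([hdn_primitive]). The
    B-spline is the Peano kernel of the divided difference, so that integrating
    it against [hdn R d n'] over [[-1, 1]] gives the divided difference of [H] at
    [cos theta_1, ..., cos theta_d] ([integral_Bspline]): by Taylor's formula
    with integral remainder the truncated powers reproduce [H] up to a
    polynomial of degree below the order of the divided difference.

    The point is that [H] can be chosen such that this divided difference is
    [E_n'(theta)] ([lagrange_dd_hdn_primitive]). In terms of generating
    functions, [E_n(theta)] is the coefficient of [r^n] in the product of the
    [(1 - r^2) / (1 - 2 r cos theta_j + r^2)], while the divided difference of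
    [x |-> 1 / (1 - 2 r x + r^2)] is [(2 r)^(d - 1)] divided by the product of
    the [1 - 2 r cos theta_j + r^2]. Hence the polynomials [H] are the
    coefficients of [(1 - r^2)^d / ((2 r)^(d - 1) (1 - 2 r x + r^2))]; those of
    negative powers of [r] have degree below [d - 1] in [x] and do not matter.
    The derivative of order [d - 1] in [x] is [(d - 1)!] times
    [(1 - r^2)^d (1 - 2 r x + r^2)^(- d)], the generating function of the
    polynomials [hdn R d n']. Instead of formal power series the proof compares
    the linear recurrences in [n] that express multiplication by
    [1 - 2 r cos theta_j + r^2] ([chebyshev_dd_sumE]).

    After exchanging the integrals over [u] and [theta], the left-hand side is
    therefore the mean of [E_n E_n' / N_d(n)] over the torus, which is [1] for
    [n = n'] and [0] otherwise by orthogonality of characters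
    ([integral_dirichlet_sumM]).

    The exchange is justified although the B-spline is unbounded in [theta]: for
    almost all [theta] the cosines are pairwise distinct ([ae_uniq_map_cos]);
    then the B-spline is nonnegative ([lagrange_dd_truncpow_ge0]) and its
    integral over [u] is [1 / (d - 1)!], so that it is integrable in [u] and
    [theta] jointly ([integrable_Bspline]). *)

Set Implicit Arguments.
Unset Strict Implicit.
Unset Printing Implicit Defensive.

Import Order.TTheory GRing.Theory Num.Theory.
Import numFieldNormedType.Exports.

Local Open Scope classical_set_scope.
Local Open Scope ring_scope.
Local Open Scope complex_scope.

(** * Divided differences in Lagrange form *)

(** Unlike the recursive definition of divided differences, the Lagrange form
    makes the symmetry in the knots evident. *)
Definition lagrange_dd (F : fieldType) (s : seq F) (f : F -> F) : F :=
  \sum_(x <- s) f x / \prod_(y <- s | y != x) (x - y).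

Section LagrangeDividedDifference.
Variable F : fieldType.
Implicit Types (a b : F) (s t : seq F) (f g : F -> F) (p : {poly F}).

Lemma eq_lagrange_dd s f g : {in s, f =1 g} -> lagrange_dd s f = lagrange_dd s g.
Proof. by move=> fg; apply: eq_big_seq => x xs; rewrite fg. Qed.

Lemma perm_lagrange_dd s t f :
  perm_eq s t -> lagrange_dd s f = lagrange_dd t f.
Proof.
move=> st; rewrite /lagrange_dd (perm_big _ st); apply: eq_bigr => x _.
by rewrite (perm_big _ st).
Qed.

Lemma lagrange_ddD s f g :
  lagrange_dd s (fun x => f x + g x) = lagrange_dd s f + lagrange_dd s g.
Proof. by rewrite -big_split; apply: eq_bigr => x _; rewrite mulrDl. Qed.

Lemma lagrange_ddZ s c f :
  lagrange_dd s (fun x => c * f x) = c * lagrange_dd s f.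
Proof. by rewrite mulr_sumr; apply: eq_bigr => x _; rewrite mulrA. Qed.

Lemma lagrange_dd_sum s (I : Type) (r : seq I) (f : I -> F -> F) :
  lagrange_dd s (fun x => \sum_(i <- r) f i x) = \sum_(i <- r) lagrange_dd s (f i).
Proof. by rewrite exchange_big; apply: eq_bigr => x _; rewrite mulr_suml. Qed.

Lemma lagrange_dd1 a f : lagrange_dd [:: a] f = f a.
Proof. by rewrite /lagrange_dd big_seq1 big_cons eqxx big_nil divr1. Qed.

(** The factor [x - a] cancels the factor of the weight of [x] that comes from
    the knot [a], and it vanishes at [a] itself. *)
Lemma lagrange_dd_mul_sub a s f : a \notin s ->
  lagrange_dd (a :: s) (fun x => (x - a) * f x) = lagrange_dd s f.
Proof.
move=> as_; rewrite /lagrange_dd big_cons subrr mul0r mul0r add0r.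
apply: eq_big_seq => x xs; rewrite big_cons.
have ax : a != x by apply: contraNneq as_ => ->.
have xa : x - a != 0 by rewrite subr_eq0 eq_sym.
by rewrite ax invfM mulrACA divff// mul1r.
Qed.

Lemma lagrange_dd_cons2 a b s f : uniq [:: a, b & s] ->
  lagrange_dd (a :: s) f - lagrange_dd (b :: s) f =
  (a - b) * lagrange_dd [:: a, b & s] f.
Proof.
move=> /= /and3P[]; rewrite inE negb_or => /andP[ab as_] bs us.
rewrite -lagrange_ddZ.
(* a - b = (x - b) - (x - a), and each of the two factors removes a knot. *)
rewrite (@eq_lagrange_dd [:: a, b & s] _
  (fun x => (x - b) * f x + (- 1) * ((x - a) * f x))); last first.
  by move=> x _ /=; ring.
rewrite lagrange_ddD lagrange_ddZ (@lagrange_dd_mul_sub a) ?inE ?negb_or ?ab//.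
rewrite (@perm_lagrange_dd [:: a, b & s] [:: b, a & s]); last first.
  by have := perm_catCA [:: a] [:: b] s => /= /permPl.
by rewrite lagrange_dd_mul_sub ?inE ?negb_or 1?eq_sym ?ab// mulN1r.
Qed.

(** Dividing [p] by ['X - a] for a knot [a] lowers both the degree of [p] and
    the number of knots; the remainder is a constant, which every divided
    difference of positive order kills. This is used mostly for [p] of degree
    below the order, where the coefficient vanishes. *)
Lemma lagrange_dd_poly s p : uniq s -> (0 < size s)%N -> (size p <= size s)%N ->
  lagrange_dd s (horner p) = p`_(size s).-1.
Proof.
have dd_cst n (u : seq F) (c : F) :
    uniq u -> size u = n.+2 -> lagrange_dd u (fun=> c) = 0.
  elim: n u => [|n IH] [|a [|b u]] // uab [su].
    rewrite (size0nil su) in uab *.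
    have := @lagrange_dd_cons2 a b [::] (fun=> c) uab.
    rewrite !lagrange_dd1 subrr => /esym/eqP; rewrite mulf_eq0 => /orP[|/eqP//].
    by rewrite subr_eq0; move: uab; rewrite /= inE => /andP[/negPf->].
  have := @lagrange_dd_cons2 a b u (fun=> c) uab.
  have ub : uniq (b :: u) by case/andP: uab.
  have ua : uniq (a :: u).
    by move: uab; rewrite /= inE negb_or => /and3P[/andP[_ ->] _ ->].
  rewrite (IH _ ua) ?(IH _ ub) /= ?su// subrr => /esym/eqP.
  rewrite mulf_eq0 => /orP[|/eqP//].
  by rewrite subr_eq0; move: uab; rewrite /= inE negb_or => /andP[/andP[/negPf->]].
elim: s p => [|a s IH] p us s0 sp; first by [].
case: s IH us {s0} sp => [|b s] IH us sp.
  by rewrite lagrange_dd1 [p in LHS]size1_polyC// hornerC.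
have [q [c pE]] : exists q c, p = q * ('X - a%:P) + c%:P.
  have /factor_theorem[q qE] : root (p - p.[a]%:P) a.
    by rewrite rootE hornerD hornerN hornerC subrr.
  by exists q, p.[a]; rewrite -qE subrK.
have sq : (size q <= size (b :: s))%N.
  have [->|q0] := eqVneq q 0; first by rewrite size_poly0.
  have sM : size (q * ('X - a%:P)) = (size q).+1.
    by rewrite size_Mmonic ?monicXsubC// size_XsubC addn2.
  move: sp; rewrite pE size_polyDl ?sM// size_polyC.
  by apply: leq_trans (_ : 1 < _)%N; [case: (c != 0)|rewrite ltnS lt0n size_poly_eq0].
rewrite (@eq_lagrange_dd _ _ (fun x => (x - a) * q.[x] + c)); last first.
  by move=> x _; rewrite pE hornerD hornerM hornerXsubC hornerC mulrC.
rewrite lagrange_ddD lagrange_dd_mul_sub; last by move: us => /= /andP[].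
rewrite (dd_cst (size s))// addr0 IH//; last by move: us => /= /andP[].
rewrite pE coefD coefC/= addr0 mulrBr coefB coefMX coefMC/=.
by rewrite (nth_default _ sq) mul0r subr0.
Qed.

End LagrangeDividedDifference.

Lemma divdiffE (R : realType) (f : R -> R) (m : nat) (x : nat -> R) :
  uniq (mkseq x m.+1) -> divdiff f m x = lagrange_dd (mkseq x m.+1) f.
Proof.
elim: m x => [|m IH] x us; first by rewrite lagrange_dd1.
pose s := mkseq (fun i => x i.+1) m.
have mkE n : mkseq x n.+1 = x 0%N :: mkseq (fun i => x i.+1) n.
  by rewrite /mkseq/= -[1%N]addn0 iotaDl -map_comp.
have E0 : mkseq x m.+1 = x 0%N :: s by [].
have E1 : mkseq (fun i => x i.+1) m.+1 = rcons s (x m.+1) by rewrite mkseqS.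
have p1 : perm_eq (rcons s (x m.+1)) (x m.+1 :: s) by rewrite perm_rcons.
have u2 : uniq [:: x 0%N, x m.+1 & s].
  rewrite -(perm_uniq (_ : perm_eq (mkseq x m.+2) _))//.
  by rewrite mkE E1 perm_cons.
have E2 : perm_eq (mkseq x m.+2) [:: x 0%N, x m.+1 & s].
  by rewrite mkE E1 perm_cons.
rewrite [LHS]/= !IH; last 2 first.
- by move: us; rewrite mkE => /andP[].
- by move: us; rewrite mkseqS rcons_uniq => /andP[].
rewrite E0 E1 (perm_lagrange_dd _ p1) lagrange_dd_cons2//.
rewrite (perm_lagrange_dd _ E2) mulrC mulKf// subr_eq0.
by move: u2; rewrite /= inE negb_or => /andP[/andP[]].
Qed.

(** * Positivity of B-splines *)

Lemma truncpowS (R : realType) k (x : R) : truncpow k.+1 x = x * truncpow k x.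
Proof. by rewrite /truncpow; case: ifP; rewrite ?mulr0// exprS. Qed.

Lemma perm_max_min (R : realDomainType) (s : seq R) : (1 < size s)%N ->
  exists a b s', [/\ perm_eq s [:: a, b & s'],
    {in s, forall x, x <= a} & {in s, forall x, b <= x}].
Proof.
move=> ss.
have ps : perm_eq (sort <=%O s) s by rewrite perm_sort.
have so : sorted <=%O (sort <=%O s) by exact: sort_le_sorted.
have so' : size (sort <=%O s) = size s by rewrite size_sort.
case E : (sort <=%O s) ps so so' => [|b t]; first by move=> _ _ e; rewrite -e in ss.
case/lastP: t {E} => [|t a] ps so so'; first by rewrite -so' in ss.
exists a, b, t; split.
- rewrite perm_sym; apply: perm_trans ps.
  have /permPl := perm_catCA [:: a] [:: b] t; move=> /perm_trans; apply => /=.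
  by rewrite perm_cons perm_sym perm_rcons.
- move=> x; rewrite -(perm_mem ps) -rcons_cons mem_rcons inE => /predU1P[->//|xt].
  move: so; rewrite -rcons_cons.
  rewrite sorted_pairwise; last exact: le_trans.
  by rewrite pairwise_rcons => /andP[/allP/(_ _ xt)].
- move=> x; rewrite -(perm_mem ps) inE => /predU1P[->//|xt].
  by move: so; rewrite /= path_sortedE; [case/andP => /allP/(_ _ xt)|exact: le_trans].
Qed.

(** With [a] the largest and [b] the smallest knot, a B-spline is the
    combination of two B-splines of lower order with coefficients proportional
    to [a - u] and [u - b]. These are nonnegative for [u] between [b] and [a];
    for the other [u] the truncated power agrees on the knots with a polynomial
    of too low degree. *)
Lemma lagrange_dd_truncpow_ge0 (R : realType) (k : nat) (s : seq R) (u : R) :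
  uniq s -> size s = k.+2 -> 0 <= lagrange_dd s (fun y => truncpow k (y - u)).
Proof.
elim: k s => [|k IH] s us ss.
  have /perm_max_min[a [b [s' [ps sa sb]]]] : (1 < size s)%N by rewrite ss.
  have s'0 : s' = [::] by apply: size0nil; move/perm_size: ps; rewrite ss /= => -[].
  move: ps; rewrite s'0 => ps; rewrite (perm_lagrange_dd _ ps).
  have uab : uniq [:: a; b] by rewrite -(perm_uniq ps).
  have := @lagrange_dd_cons2 _ a b [::] (fun y => truncpow 0 (y - u)) uab.
  rewrite !lagrange_dd1 => E.
  have ba : b < a.
    rewrite lt_neqAle sb ?(perm_mem ps) ?inE ?eqxx// andbT eq_sym.
    by move: uab; rewrite /= inE => /andP[].
  have ab0 : 0 < a - b by rewrite subr_gt0.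
  rewrite -(pmulr_rge0 _ ab0) -E subr_ge0 /truncpow.
  rewrite !expr0; case: ifPn => bu; case: ifPn => au //.
  by move: au; rewrite (lt_trans bu)// ltrD2r.
have /perm_max_min[a [b [s' [ps sa sb]]]] : (1 < size s)%N by rewrite ss.
have uab : uniq [:: a, b & s'] by rewrite -(perm_uniq ps).
have [ub|bu] := ltP u b.
  rewrite (@eq_lagrange_dd _ _ _ (horner (('X - u%:P) ^+ k.+1))); last first.
    move=> x xs; rewrite /truncpow subr_gt0 (lt_le_trans ub) ?sb//.
    by rewrite horner_exp hornerXsubC.
  rewrite lagrange_dd_poly// ?ss// ?size_exp_XsubC//.
  by rewrite nth_default// size_exp_XsubC.
have [au|ua] := leP a u.
  rewrite (@eq_lagrange_dd _ _ _ (fun=> 0)).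
    by rewrite /lagrange_dd big1// => x _; rewrite mul0r.
  by move=> x xs; rewrite /truncpow subr_gt0 ltNge (le_trans (sa _ xs)).
have ab0 : 0 < a - b by rewrite subr_gt0 (le_lt_trans bu).
rewrite (perm_lagrange_dd _ ps) -(pmulr_rge0 _ ab0).
set g := fun y => truncpow k (y - u).
have us' : uniq s' by move: uab => /= /and3P[].
have as' : a \notin s' by move: uab => /= /and3P[]; rewrite inE negb_or => /andP[].
have bs' : b \notin s' by move: uab => /= /and3P[].
have ss' : size s' = k.+1 by move/perm_size: ps; rewrite ss /= => -[].
have -> : (a - b) * lagrange_dd [:: a, b & s'] (fun y => truncpow k.+1 (y - u)) =
    (a - u) * lagrange_dd (a :: s') g + (u - b) * lagrange_dd (b :: s') g.
  rewrite (@eq_lagrange_dd _ _ _ (fun x => (x - a) * g x + (a - u) * g x)); last first.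
    by move=> x _; rewrite truncpowS /g /=; ring.
  rewrite lagrange_ddD lagrange_ddZ lagrange_dd_mul_sub; last by move: uab => /= /andP[].
  rewrite mulrDr mulrCA -lagrange_dd_cons2//; ring.
by rewrite addr_ge0// mulr_ge0// ?subr_ge0 ?(ltW ua)// IH//= ?as' ?bs' ?us' ?ss'.
Qed.

(** * Gegenbauer polynomials *)

Section Gegenbauer.
Variable R : realType.
Implicit Types (l : R) (p q : {poly {poly R}}).

(* The generating function of the Gegenbauer polynomials is (1 - y)^(- l). *)
Let y : {poly {poly R}} := ('X *+ 2)%:P * 'X - 'X^2.

Let coef_y_exp k m : (m < k)%N -> (y ^+ k)`_m = 0.
Proof.
have -> : y = (('X *+ 2)%:P - 'X) * 'X by rewrite /y mulrBl expr2.
by move=> mk; rewrite exprMn coefMXn mk.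
Qed.

Let coef_yM p m : (y * p)`_m.+2 = ('X *+ 2) * p`_m.+1 - p`_m.
Proof.
by rewrite /y mulrBl coefB -mulrA coefCM coefXM coefXnM/= subSS subSS subn0.
Qed.

(* Differentiation in the inner variable, at fixed exponent of the outer one. *)
Let cD p : {poly {poly R}} := map_poly deriv p.

Let coef_cD p i : (cD p)`_i = (p`_i)^`().
Proof. by rewrite coef_map_id0// linear0. Qed.

Let cD_M p q : cD (p * q) = cD p * q + p * cD q.
Proof.
apply/polyP => i; rewrite coef_cD coefD !coefM raddf_sum -big_split/=.
by apply: eq_bigr => j _; rewrite derivM !coef_cD.
Qed.

Let cD_y : cD y = 2%:P%:P * 'X.
Proof.
apply/polyP => i; rewrite coef_cD !(coefB, coefCM, coefX, coefXn).
case: i => [|[|[|i]]];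
  rewrite !(mulr0, mulr1, subr0, sub0r, linear0, derivN, derivC, oppr0)//=.
by rewrite derivMn derivX polyC_natr.
Qed.

Let cD_y_exp k : cD (y ^+ k.+1) = k.+1%:R * (y ^+ k * (2%:P%:P * 'X)).
Proof.
elim: k => [|k IH]; first by rewrite expr1 cD_y expr0 !mul1r.
by rewrite exprS cD_M IH cD_y -[in RHS]natr1 exprS; ring.
Qed.

Lemma pochhammerS l k : pochhammer l k.+1 = l * pochhammer (l + 1) k.
Proof.
rewrite /pochhammer big_ord_recl addr0; congr (_ * _).
by apply: eq_bigr => i _; rewrite lift0 -nat1r addrA.
Qed.

Lemma pochhammer1 k : pochhammer 1 k = k`!%:R :> R.
Proof.
elim: k => [|k IH]; first by rewrite /pochhammer big_ord0.
by rewrite /pochhammer big_ord_recr/= -/(pochhammer _ _) IH nat1r factS natrM mulrC.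
Qed.

Lemma gegenbauer_natE l n : gegenbauer_nat l n =
  \sum_(k < n.+1) (pochhammer l k / k`!%:R) *: (y ^+ k)`_n.
Proof.
rewrite /gegenbauer_nat coef_sum; apply: eq_bigr => k _.
by rewrite coefZ -[RHS]mul_polyC.
Qed.

(** In the inner variable [y] has derivative [2 r], so that differentiating
    [(1 - y)^(- l)] yields [2 l r (1 - y)^(- (l + 1))]. *)
Lemma deriv_gegenbauer l (n : int) :
  (gegenbauer l n)^`() = (2 * l) *: gegenbauer (l + 1) (n - 1).
Proof.
case: n => [[|n]|n]; last first.
- by rewrite NegzE -opprD -PoszD/= linear0 scaler0.
- have -> : n.+1%:Z - 1 = n by lia.
  rewrite /= !gegenbauer_natE raddf_sum big_ord_recl/=.
  rewrite expr0 coef1 scaler0 linear0 add0r scaler_sumr; apply: eq_bigr => k _.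
  rewrite derivZ -coef_cD /bump leq0n add1n cD_y_exp mulr_natl coefMn mulrA.
  rewrite coefMX/= coefMC.
  rewrite [_ * 2%:P]mulrC mul_polyC scalerMnl !scalerA; congr (_ *: _).
  rewrite pochhammerS factS natrM -[2 *+ _]mulr_natr.
  have k0 : k.+1%:R != 0 :> R by rewrite pnatr_eq0.
  have kf0 : k`!%:R != 0 :> R by rewrite pnatr_eq0 -lt0n fact_gt0.
  by field; rewrite kf0 nat1r k0.
- by rewrite /= gegenbauer_natE big_ord1 expr0 coef1/= derivZ derivC !scaler0.
Qed.

Lemma derivn_gegenbauer l (n : int) k :
  (gegenbauer l n)^`(k) =
  (2 ^+ k * pochhammer l k) *: gegenbauer (l + k%:R) (n - k%:Z).
Proof.
elim: k => [|k IH].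
  by rewrite derivn0 expr0 mul1r /pochhammer big_ord0 scale1r addr0 subr0.
rewrite derivnS IH derivZ deriv_gegenbauer scalerA -addrA natr1.
congr (_ *: gegenbauer _ _).
  by rewrite /pochhammer big_ord_recr/= exprS; ring.
lia.
Qed.

(** This is [(1 - y) * (1 - y)^-1 = 1] read coefficientwise: the polynomials of
    parameter [1] are the Chebyshev polynomials of the second kind. *)
Lemma gegenbauer1_rec (n : int) :
  gegenbauer 1 (n + 1) - ('X *+ 2) * gegenbauer 1 n + gegenbauer 1 (n - 1) =
  (n == -1)%:R :> {poly R}.
Proof.
have E m : gegenbauer_nat 1 m = \sum_(k < m.+1) (y ^+ k)`_m :> {poly R}.
  rewrite gegenbauer_natE; apply: eq_bigr => k _.
  by rewrite pochhammer1 divff ?scale1r// pnatr_eq0 -lt0n fact_gt0.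
case: n => [[|n]|[|n]].
- rewrite add0r /= !E !big_ord_recl !big_ord0/= expr0 expr1 !addr0 !coef1/=.
  by rewrite coefB coefCM coefX coefXn/= !mulr1 subr0 add0r subrr.
- have -> : n.+1%:Z + 1 = n.+2 by lia.
  have -> : n.+1%:Z - 1 = n by lia.
  rewrite /= !E big_ord_recl expr0 coef1/= add0r.
  under eq_bigr do rewrite /bump leq0n add1n exprS coef_yM.
  rewrite sumrB -mulr_sumr [X in _ - X - _]big_ord_recr/= coef_y_exp// addr0.
  by rewrite addrAC subrK subrr.
- by rewrite /= E big_ord1 expr0 coef1 mulr0 subr0 addr0.
- by rewrite /= mulr0 subr0 addr0.
Qed.

Lemma gegenbauer1_rec_horner (n : int) (a x : R) :
  (gegenbauer 1 (n + 1)).[x] - 2 * a * (gegenbauer 1 n).[x] +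
    (gegenbauer 1 (n - 1)).[x] =
  (n == -1)%:R + 2 * ((x - a) * (gegenbauer 1 n).[x]).
Proof.
have := congr1 (horner^~ x) (gegenbauer1_rec n).
rewrite !(hornerD, hornerN, hornerM, hornerMn, hornerX, hornerC).
by move=> <-; ring.
Qed.

Lemma size_gegenbauer1 (n : nat) : (size (gegenbauer 1 n : {poly R}) <= n.+1)%N.
Proof.
suff: (size (gegenbauer 1 n : {poly R}) <= n.+1)%N /\
  (size (gegenbauer 1 n.+1 : {poly R}) <= n.+2)%N by case.
have rec (m : int) : gegenbauer 1 (m + 1) =
    (m == -1)%:R + ('X *+ 2) * gegenbauer 1 m - gegenbauer 1 (m - 1) :> {poly R}.
  by rewrite -gegenbauer1_rec; ring.
have s2X : (size ('X *+ 2 : {poly R}) <= 2)%N.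
  by rewrite -scaler_nat (leq_trans (size_scale_leq _ _))// size_polyX.
have sX (p : {poly R}) m : (size p <= m)%N -> (size (('X *+ 2) * p)%R <= m.+1)%N.
  move=> pm; rewrite (leq_trans (size_polyMleq _ _))//.
  by lia.
have U0 : gegenbauer 1 0 = 1 :> {poly R}.
  by have := rec (-1); rewrite addNr eqxx mulr0 addr0 subr0.
elim: n => [|n [IH0 IH1]].
  rewrite U0 size_poly1; split=> //.
  by have := rec 0; rewrite add0r => ->; rewrite U0 mulr1 add0r subr0.
split=> //; have -> : n.+2%:Z = n.+1%:Z + 1 by lia.
rewrite rec add0r (leq_trans (size_polyD _ _))// geq_max sX// size_polyN.
have -> : n.+1%:Z - 1 = n by lia.
by rewrite (leq_trans IH0)// leqW.
Qed.

End Gegenbauer.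

(** * Dirichlet sums as divided differences *)

Section DirichletSums.
Variable R : realType.
Implicit Types (t a : R) (s : seq R) (n : int).

(** The sum of the characters of the circle whose frequency has absolute value
    [k], which is real. *)
Definition dirichlet_term (k : nat) t : R :=
  if k == 0 then 1 else 2 * cos (k%:R * t).

(** The real form of [Edn]. Splitting off the first entry of the frequency
    vector splits its l1-norm, whence the convolution; in terms of generating
    functions in [n], each angle contributes the factor
    [(1 - r^2) / (1 - 2 r cos t + r^2)]. *)
Fixpoint dirichlet_sum s (n : nat) : R :=
  if s is t :: s' then
    \sum_(k < n.+1) dirichlet_term k t * dirichlet_sum s' (n - k)
  else (n == 0)%:R.

Lemma dirichlet_sum_cons t s (n : nat) : dirichlet_sum (t :: s) n =
  \sum_(k < n.+1) dirichlet_term k t * dirichlet_sum s (n - k).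
Proof. by []. Qed.

(** The recurrences below have no boundary cases when the sums are extended by
    zero to negative indices. *)
Definition dirichlet_sumz s n : R := if n is Posz m then dirichlet_sum s m else 0.

Lemma dirichlet_term_rec k t : dirichlet_term k.+2 t =
  2 * cos t * dirichlet_term k.+1 t - dirichlet_term k t - (k == 0)%:R.
Proof.
have E (x : R) : cos (x + t) = 2 * cos t * cos x - cos (x - t).
  by rewrite cosD cosB; ring.
have e m : m.+1%:R * t = m%:R * t + t by rewrite -natr1 mulrDl mul1r.
case: k => [|k]; rewrite /dirichlet_term/=.
  by rewrite (e 1%N) E mul1r subrr cos0; ring.
by rewrite subr0 (e k.+2) E [in cos (_ - t)](e k.+1) addrK; ring.
Qed.

(** Multiplication of the generating function by [1 - 2 r cos t + r^2] leaves
    that of [s] times [1 - r^2]. *)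
Lemma dirichlet_sumz_rec t s n :
  dirichlet_sumz (t :: s) (n + 1) - 2 * cos t * dirichlet_sumz (t :: s) n +
    dirichlet_sumz (t :: s) (n - 1) =
  dirichlet_sumz s (n + 1) - dirichlet_sumz s (n - 1).
Proof.
case: n => [[|n]|[|n]]; last 2 first.
- by rewrite /= big_ord1 /dirichlet_term/= mul1r mulr0 !subr0 addr0.
- by rewrite /= mulr0 subrr addr0.
- rewrite add0r /= big_ord_recl !big_ord1 /dirichlet_term/= !mul1r.
  by rewrite /bump leq0n addn0 subnn subn0; ring.
have -> : n.+1%:Z + 1 = n.+2 by lia.
have -> : n.+1%:Z - 1 = n by lia.
rewrite /dirichlet_sumz.
have -> : dirichlet_sum (t :: s) n.+2 =
    dirichlet_sum s n.+2 + 2 * cos t * dirichlet_sum s n.+1 +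
    \sum_(i < n.+1) dirichlet_term i.+2 t * dirichlet_sum s (n - i).
  rewrite [LHS]/= 2!big_ord_recl /dirichlet_term/= !mul1r -[RHS]addrA.
  by congr (_ + (_ + _)).
have -> : dirichlet_sum (t :: s) n.+1 = dirichlet_sum s n.+1 +
    \sum_(i < n.+1) dirichlet_term i.+1 t * dirichlet_sum s (n - i).
  rewrite [LHS]/= big_ord_recl /dirichlet_term/= mul1r; congr (_ + _).
have -> : \sum_(i < n.+1) dirichlet_term i.+2 t * dirichlet_sum s (n - i) =
    2 * cos t * (\sum_(i < n.+1) dirichlet_term i.+1 t * dirichlet_sum s (n - i))
    - dirichlet_sum (t :: s) n - dirichlet_sum s n.
  rewrite dirichlet_sum_cons mulr_sumr -sumrB.
  rewrite -[X in _ - X](_ : \sum_(i < n.+1)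
    (i == 0%N :> nat)%:R * dirichlet_sum s (n - i) = _); last first.
    rewrite big_ord_recl/= subn0 mul1r big1 ?addr0// => i _.
    by rewrite /bump leq0n add1n mul0r.
  by rewrite -sumrB; apply: eq_bigr => i _; rewrite dirichlet_term_rec; ring.
ring.
Qed.

Lemma second_order_rec_uniq (a : R) (F G H : int -> R) :
  (forall n, n < 0 -> F n = 0) -> (forall n, n < 0 -> G n = 0) ->
  (forall n, F (n + 1) - a * F n + F (n - 1) = H n) ->
  (forall n, G (n + 1) - a * G n + G (n - 1) = H n) -> F =1 G.
Proof.
move=> F0 G0 recF recG.
suff E (m : nat) : F m = G m /\ F (m%:Z - 1) = G (m%:Z - 1).
  by case=> m; [case: (E m)|rewrite F0 ?G0].
elim: m => [|m [IH0 IH1]].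
  rewrite [F (0%Z - 1)]F0 ?[G (0%Z - 1)]G0//; split=> //.
  have := recF (-1); have := recG (-1).
  rewrite addNr !(F0 (-1)) ?(F0 (-1 - 1)) ?(G0 (-1)) ?(G0 (-1 - 1))//.
  by rewrite !(mulr0, subr0, addr0) => -> ->.
have -> : m.+1%:Z - 1 = m by lia.
split=> //; have -> : m.+1%:Z = m%:Z + 1 by lia.
have := recF m; have := recG m; rewrite IH0 IH1 => <-.
by move=> /addIr /addIr.
Qed.

Definition chebyshev_dd s n : R :=
  lagrange_dd s (fun x => (gegenbauer 1 n).[x]).

(** For [Q_x(r) = 1 - 2 r x + r^2] the difference [Q_a - Q_x] is [2 r (x - a)], so
    that the generating function [1 / Q_x] multiplied by [Q_a] is
    [1 + 2 r (x - a) / Q_x]. Divided differences of positive order kill the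
    constant, and the factor [x - a] removes the knot [a]. *)
Lemma chebyshev_dd_rec a s n : uniq (a :: s) -> s != [::] ->
  chebyshev_dd (a :: s) (n + 1) - 2 * a * chebyshev_dd (a :: s) n +
    chebyshev_dd (a :: s) (n - 1) = 2 * chebyshev_dd s n.
Proof.
move=> /[dup] us /andP[as_ _] s0.
pose U m (x : R) := (gegenbauer 1 m).[x].
transitivity (lagrange_dd (a :: s)
    (fun x => U (n + 1) x + (- (2 * a)) * U n x + U (n - 1) x)).
  by rewrite !lagrange_ddD lagrange_ddZ mulNr.
rewrite (@eq_lagrange_dd _ _ _
    (fun x => (n == -1)%:R%:P.[x] + 2 * ((x - a) * U n x))); last first.
  by move=> x _; rewrite hornerC -gegenbauer1_rec_horner mulNr.
rewrite lagrange_ddD lagrange_ddZ lagrange_dd_mul_sub// lagrange_dd_poly//.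
  by rewrite coefC/= size_eq0 (negPf s0) add0r.
by rewrite (leq_trans (size_polyC_leq1 _)).
Qed.

Lemma chebyshev_dd_small s n : uniq s -> n < (size s)%:Z - 1 -> chebyshev_dd s n = 0.
Proof.
case: n => [n|n] us ns; last first.
  by apply: big1 => x _; rewrite /= horner0 mul0r.
have sU := @size_gegenbauer1 R n.
have ns' : (n.+1 <= (size s).-1)%N by move: ns; lia.
rewrite /chebyshev_dd lagrange_dd_poly//; first by rewrite nth_default// (leq_trans sU).
  by move: ns'; case: (size s).
by rewrite (leq_trans sU)// (leq_trans ns')// leq_pred.
Qed.

(** Coefficient of [r^n] in [(1 - r^2)^d / (2 r)^(d - 1)] times the divided
    difference of [1 / (1 - 2 r x + r^2)] in [x], where [d > 0] is the number of
    knots. *)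
Definition chebyshev_dd_sum s n : R :=
  2^-1 ^+ (size s).-1 * \sum_(j < (size s).+1)
    (-1) ^+ j * 'C(size s, j)%:R * chebyshev_dd s (n + (size s).-1%:Z - (2 * j)%:Z).

Lemma chebyshev_dd_sum_small s n : uniq s -> s != [::] -> n < 0 ->
  chebyshev_dd_sum s n = 0.
Proof.
rewrite -size_eq0 => us s0 n0; rewrite /chebyshev_dd_sum big1 ?mulr0// => j _.
by rewrite chebyshev_dd_small ?mulr0//; case: (size s) s0 j => [|m]// _ j /=; lia.
Qed.

Lemma chebyshev_dd_sum1_rec a n :
  chebyshev_dd_sum [:: a] (n + 1) - 2 * a * chebyshev_dd_sum [:: a] n +
    chebyshev_dd_sum [:: a] (n - 1) =
  dirichlet_sumz [::] (n + 1) - dirichlet_sumz [::] (n - 1).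
Proof.
have E m : chebyshev_dd_sum [:: a] m =
    chebyshev_dd [:: a] m - chebyshev_dd [:: a] (m - 2).
  rewrite /chebyshev_dd_sum expr0 mul1r !big_ord_recl big_ord0/=.
  have -> : m + 0%:Z - (2 * 0)%:Z = m by lia.
  have -> : m + 0%:Z - (2 * bump 0 0)%:Z = m - 2 by rewrite /bump; lia.
  by rewrite /bump leq0n addn0 bin0 bin1 expr0 expr1 !mul1r mulr1 mulN1r addr0.
have F m : dirichlet_sumz [::] m = (m == 0)%:R by case: m.
have rec m : chebyshev_dd [:: a] (m + 1) - 2 * a * chebyshev_dd [:: a] m +
    chebyshev_dd [:: a] (m - 1) = (m == -1)%:R.
  by rewrite /chebyshev_dd !lagrange_dd1 gegenbauer1_rec_horner subrr mul0r mulr0 addr0.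
rewrite !F; have -> : (n + 1 == 0) = (n == -1) by lia.
have -> : (n - 1 == 0) = (n - 2 == -1) by lia.
rewrite !E -!rec.
have -> : n + 1 - 2 = n - 2 + 1 by lia.
have -> : n - 1 - 2 = n - 2 - 1 by lia.
ring.
Qed.

Lemma chebyshev_dd_sum_rec a s n : uniq (a :: s) -> s != [::] ->
  chebyshev_dd_sum (a :: s) (n + 1) - 2 * a * chebyshev_dd_sum (a :: s) n +
    chebyshev_dd_sum (a :: s) (n - 1) =
  chebyshev_dd_sum s (n + 1) - chebyshev_dd_sum s (n - 1).
Proof.
move=> us s0; set d := size s.
have d0 : (0 < d)%N by rewrite lt0n size_eq0.
pose D m := chebyshev_dd s m.
pose E m := chebyshev_dd (a :: s) m.
pose c k j : R := (-1) ^+ j * 'C(k, j)%:R.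
have -> : chebyshev_dd_sum (a :: s) (n + 1) - 2 * a * chebyshev_dd_sum (a :: s) n +
    chebyshev_dd_sum (a :: s) (n - 1) =
    2^-1 ^+ d * \sum_(j < d.+2) c d.+1 j * (2 * D (n + d%:Z - (2 * j)%:Z)).
  rewrite /chebyshev_dd_sum [size (a :: s)]/= -/d /=.
  rewrite mulrCA -mulrBr -mulrDr mulr_sumr -sumrB -big_split/=; congr (_ * _).
  apply: eq_bigr => j _; rewrite /D -(@chebyshev_dd_rec a)// -/(c d.+1 j).
  have -> : n + 1 + d%:Z - (2 * j)%:Z = n + d%:Z - (2 * j)%:Z + 1 by lia.
  have -> : n - 1 + d%:Z - (2 * j)%:Z = n + d%:Z - (2 * j)%:Z - 1 by lia.
  ring.
have -> : 2^-1 ^+ d * (\sum_(j < d.+2) c d.+1 j * (2 * D (n + d%:Z - (2 * j)%:Z))) =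
    2^-1 ^+ d.-1 * \sum_(j < d.+2) c d.+1 j * D (n + d%:Z - (2 * j)%:Z).
  under eq_bigr do rewrite mulrCA.
  rewrite -mulr_sumr mulrA; congr (_ * _).
  by rewrite -[d in LHS]prednK// exprSr mulfVK// pnatr_eq0.
rewrite /chebyshev_dd_sum -/d -mulrBr; congr (_ * _).
rewrite big_ord_recl.
have cS j : c d.+1 j.+1 = c d j.+1 - c d j.
  by rewrite /c binS natrD exprS; ring.
under eq_bigr do rewrite lift0 cS mulrBl.
rewrite sumrB addrA; congr (_ - _).
- rewrite big_ord_recr/= [c d d.+1](_ : _ = 0) ?mul0r ?addr0; last first.
    by rewrite /c bin_small// mulr0.
  rewrite [RHS]big_ord_recl; congr (_ + _).
    by rewrite /c !bin0; congr (_ * chebyshev_dd _ _) => /=; lia.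
  apply: eq_bigr => j _; rewrite lift0; congr (_ * chebyshev_dd _ _) => /=; lia.
- apply: eq_bigr => j _; congr (_ * chebyshev_dd _ _) => /=; lia.
Qed.

(** Both sides vanish for negative [n] and, when an angle [t] is added,
    satisfy the same second order recurrence, with right-hand side given by the
    remaining angles. *)
Lemma chebyshev_dd_sumE (th : seq R) n : uniq (map (@cos R) th) -> th != [::] ->
  chebyshev_dd_sum (map (@cos R) th) n = dirichlet_sumz th n.
Proof.
elim: th n => [//|t th IH] n uth _.
apply: (@second_order_rec_uniq (2 * cos t) _ _
  (fun n => dirichlet_sumz th (n + 1) - dirichlet_sumz th (n - 1))).
- by move=> m; exact: chebyshev_dd_sum_small.
- by case.
- move=> m; have [->|th0] := eqVneq th [::]; first exact: chebyshev_dd_sum1_rec.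
  rewrite chebyshev_dd_sum_rec//; last by case: (th) th0.
  by rewrite !IH//; case/andP: uth.
- by move=> m; exact: dirichlet_sumz_rec.
Qed.

End DirichletSums.

Section HdnPrimitive.
Variable R : realType.

(** The coefficient of [r^n] in
    [(1 - r^2)^d / ((2 r)^(d - 1) (1 - 2 r x + r^2))]. *)
Definition hdn_primitive (d n : nat) : {poly R} :=
  2^-1 ^+ d.-1 *: \sum_(j < d.+1) ((-1) ^+ j * 'C(d, j)%:R) *:
    gegenbauer 1 (n%:Z + d.-1%:Z - (2 * j)%:Z).

Lemma derivn_hdn_primitive (d n : nat) : (0 < d)%N ->
  (hdn_primitive d n)^`(d.-1) = hdn R d n.
Proof.
case: d => // d _; rewrite /hdn_primitive derivnZ/= /hdn/=.
have dsum (I : finType) (P : I -> {poly R}) : (\sum_i P i)^`(d) = \sum_i (P i)^`(d).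
  by elim/big_rec2 : _ => [|i p q _ <-]; rewrite ?linear0 ?derivnD// derivnC; case: d.
rewrite dsum !scaler_sumr; apply: eq_bigr => j _.
rewrite derivnZ derivn_gegenbauer !scalerA nat1r; congr (_ *: gegenbauer _ _); last lia.
rewrite pochhammer1 mulrCA !mulrA -exprMn mulfV ?pnatr_eq0// expr1n mul1r; ring.
Qed.

Lemma lagrange_dd_hdn_primitive (th : seq R) (n : nat) :
  uniq (map (@cos R) th) -> th != [::] ->
  lagrange_dd (map (@cos R) th) (horner (hdn_primitive (size th) n)) =
  dirichlet_sum th n.
Proof.
move=> uth th0; have := chebyshev_dd_sumE n uth th0.
rewrite /= /chebyshev_dd_sum size_map => <-.
rewrite (@eq_lagrange_dd _ _ _ (fun x => 2^-1 ^+ (size th).-1 *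
  \sum_(j < (size th).+1) ((-1) ^+ j * 'C(size th, j)%:R) *
    (gegenbauer 1 (n%:Z + (size th).-1%:Z - (2 * j)%:Z)).[x])); last first.
  move=> x _; rewrite /hdn_primitive hornerZ horner_sum; congr (_ * _).
  by apply: eq_bigr => j _; rewrite hornerZ.
rewrite lagrange_ddZ lagrange_dd_sum; congr (_ * _).
by apply: eq_bigr => j _; rewrite lagrange_ddZ.
Qed.

End HdnPrimitive.

(** * Sums over the l1-sphere *)

Section Edn.
Variable R : realType.

Lemma cexpiD (x y : R) : cexpi (x + y) = cexpi x * cexpi y.
Proof.
rewrite /cexpi cosD sinD; apply/eqP; rewrite eq_complex/=.
by rewrite eqxx/= [X in _ == X]addrC eqxx.
Qed.

Definition ffun_cons (T : Type) d (z : T) (b : {ffun 'I_d -> T}) :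
    {ffun 'I_d.+1 -> T} :=
  [ffun i => oapp b z (unlift ord0 i)].

Lemma ffun_cons0 (T : Type) d (z : T) (b : {ffun 'I_d -> T}) :
  ffun_cons z b ord0 = z.
Proof. by rewrite ffunE unlift_none. Qed.

Lemma ffun_consS (T : Type) d (z : T) (b : {ffun 'I_d -> T}) i :
  ffun_cons z b (lift ord0 i) = b i.
Proof. by rewrite ffunE liftK. Qed.

Definition int_ball (n : nat) : seq int :=
  [seq Posz k | k <- iota 0 n.+1] ++ [seq Negz k | k <- iota 0 n].

Arguments int_ball : simpl never.

Lemma mem_int_ball n z : (z \in int_ball n) = (`|z| <= n)%N.
Proof.
rewrite mem_cat; case: z => k.
- rewrite mem_map ?mem_iota ?add0n//; last by move=> ? ? [].
  by rewrite orb_idr// => /mapP[].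
- rewrite orbC mem_map ?mem_iota ?add0n//; last by move=> ? ? [].
  by rewrite orb_idr// => /mapP[].
Qed.

Lemma uniq_int_ball n : uniq (int_ball n).
Proof.
rewrite cat_uniq !map_inj_uniq ?iota_uniq//=; try by move=> ? ? [].
by rewrite andbT; apply/hasPn => x /mapP[k _ ->]; apply/mapP => -[].
Qed.

(** An enumeration of the l1-sphere that follows the recursion of
    [dirichlet_sum]. *)
Fixpoint l1seq (d n : nat) : seq {ffun 'I_d -> int} :=
  if d is d'.+1 then
    [seq ffun_cons z b | z <- int_ball n, b <- l1seq d' (n - `|z|)]
  else if n == 0 then [:: [ffun _ => 0]] else [::].

Lemma mem_l1seq d n a : (a \in l1seq d n) = (\sum_(i < d) `|a i| == n)%N.
Proof.
elim: d n a => [|d IH] n a.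
  rewrite big_ord0 /= eq_sym; case: eqP => // _.
  by rewrite inE; apply/eqP/ffunP => -[].
rewrite big_ord_recl; apply/allpairsPdep/eqP => [[z [b [zn bn ->]]]|an].
  rewrite ffun_cons0; under eq_bigr do rewrite ffun_consS.
  by move: zn bn; rewrite mem_int_ball IH => zn /eqP ->; rewrite subnKC.
exists (a ord0), [ffun i => a (lift ord0 i)]; split.
- by rewrite mem_int_ball -an leq_addr.
- by rewrite IH -an addKn; under eq_bigr do rewrite ffunE.
- apply/ffunP => i; case: (unliftP ord0 i) => [j|] ->.
  + by rewrite ffun_consS ffunE.
  + by rewrite ffun_cons0.
Qed.

Lemma uniq_l1seq d n : uniq (l1seq d n).
Proof.
elim: d n => [|d IH] n /=; first by case: ifP.
apply: (@allpairs_uniq_dep _ _ _ (@ffun_cons int d) (int_ball n)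
  (fun z : int => l1seq d (n - `|z|))).
- exact: uniq_int_ball.
- by move=> z _; exact: IH.
move=> [z b] [z' b'] _ _ /= e; have z_ : z = z'.
  by have := ffun_cons0 z b; rewrite e ffun_cons0.
rewrite z_ in e *; congr existT; apply/ffunP => i.
by rewrite -(ffun_consS z' b) e ffun_consS.
Qed.

Lemma fset_set_l1sphere d n : perm_eq (fset_set (@l1sphere d n)) (l1seq d n).
Proof.
apply: uniq_perm; [exact: fset_uniq|exact: uniq_l1seq|] => a.
rewrite mem_l1seq in_fset_set; last exact: finite_l1sphere.
by apply/idP/eqP => [/set_mem|/mem_set].
Qed.

Lemma sum_l1sphere (V : nmodType) d n (F : {ffun 'I_d -> int} -> V) :
  \sum_(a \in @l1sphere d n) F a = \sum_(a <- l1seq d n) F a.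
Proof.
by rewrite fsbig_finite/=; [exact/perm_big/fset_set_l1sphere|exact: finite_l1sphere].
Qed.

Lemma sum_int_ball n (t : R) (g : nat -> R) :
  \sum_(z <- int_ball n) cexpi (z%:~R * t) * (g (n - `|z|)%N)%:C =
  (\sum_(k < n.+1) dirichlet_term k t * g (n - k)%N)%:C.
Proof.
rewrite /int_ball big_cat !big_map/= big_cons -[1%N]addn0 iotaDl big_map.
rewrite -addrA -big_split/= (_ : iota 0 n = index_iota 0 n) ?/index_iota ?subn0//.
rewrite -[iota _ _]/(iota 0 n) -{1}[n in iota 0 n]subn0 big_mkord.
rewrite mul0r /cexpi cos0 sin0 big_ord_recl rmorphD rmorph_sum/= subn0.
congr (_ + _); first by rewrite /dirichlet_term/= mul1r; simpc.
apply: eq_bigr => k _; rewrite add1n -mulrDl NegzE.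
rewrite rmorphM; congr (_ * _).
rewrite mulrNz mulNr cosN sinN /dirichlet_term /bump leq0n add1n /=.
apply/eqP; rewrite eq_complex/= subrr eqxx andbT -pmulrn.
by rewrite mulr_natl mulr2n.
Qed.

Lemma EdnE d n (th : d.-tuple R) : Edn n th = (dirichlet_sum th n)%:C.
Proof.
rewrite /Edn sum_l1sphere.
elim: d n th => [|d IH] n th.
  rewrite tuple0/=; case: eqP => _; rewrite ?big_nil// big_seq1 big_ord0.
  by rewrite /cexpi cos0 sin0.
case/tupleP: th => t th; rewrite [LHS]big_allpairs_dep/= -sum_int_ball.
apply: eq_bigr => z _; rewrite -IH mulr_sumr; apply: eq_bigr => b _.
rewrite -cexpiD big_ord_recl ffun_cons0; congr (cexpi (_ + _)).
by apply: eq_bigr => i _; rewrite ffun_consS tnthS.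
Qed.

(** At the origin all characters take the value one. *)
Lemma NdnE d n : (Ndn d n)%:R = dirichlet_sum (nseq d 0) n :> R.
Proof.
have := EdnE n [tuple of nseq d 0] => /(congr1 (@complex.Re R))/= <-.
rewrite /Edn /Ndn fsbig_finite/=; last exact: finite_l1sphere.
under eq_bigr => a _.
  rewrite big1; last first.
    by move=> i _; rewrite (tnth_nth 0) nth_nseq; case: ifP; rewrite mulr0.
  rewrite /cexpi cos0 sin0.
  over.
by rewrite raddf_sum/= big_const_seq count_predT iter_addr_0.
Qed.

Lemma Ndn_gt0 d n : (0 < d)%N -> (0 < Ndn d n)%N.
Proof.
case: d => // d _; rewrite /Ndn (perm_size (fset_set_l1sphere _ _)).
suff : [ffun i => if i == ord0 then n%:Z else 0] \in l1seq d.+1 n by case: l1seq.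
rewrite mem_l1seq big_ord_recl ffunE eqxx big1 ?addn0// => i _.
by rewrite ffunE.
Qed.

End Edn.

(** * B-splines as Peano kernels *)

Section PeanoKernel.
Variable R : realType.
Let mu := @lebesgue_measure R.
Implicit Types (p H : {poly R}) (y u : R) (s : seq R).

Lemma integrable_horner p (a b : R) : mu.-integrable `[a, b] (EFin \o horner p).
Proof.
apply: continuous_compact_integrable; first exact: segment_compact.
by apply: continuous_subspaceT => x; exact: continuous_horner.
Qed.

Lemma integral_deriv_poly p (a b : R) : a <= b ->
  (\int[mu]_(x in `[a, b]) (p^`()).[x]%:E = (p.[b] - p.[a])%:E)%E.
Proof.
rewrite le_eqVlt => /predU1P[->|ab].
  by rewrite set_itv1 integral_set1 subrr.
rewrite (@continuous_FTC2 _ _ (horner p))//.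
- by apply: continuous_subspaceT => x; exact: continuous_horner.
- split => [x _||].
  + exact: derivable_horner.
  + by apply: cvg_at_right_filter; exact: continuous_horner.
  + by apply: cvg_at_left_filter; exact: continuous_horner.
- by move=> x _; rewrite derivE.
Qed.

(** The value at [y] of the Taylor polynomial of [H] with [k] terms, as a
    function of the base point; this makes its derivative telescope. *)
Definition taylor_at H y (k : nat) : {poly R} :=
  \sum_(i < k) i`!%:R^-1 *: ((y%:P - 'X) ^+ i * H^`(i)).

Lemma deriv_taylor_at H y k : (taylor_at H y k.+1)^`() =
  k`!%:R^-1 *: ((y%:P - 'X) ^+ k * H^`(k.+1)).
Proof.
elim: k => [|k IH].
  rewrite /taylor_at big_ord1 fact0 invr1 !scale1r !expr0 !mul1r derivn0.
  by rewrite derivn1.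
rewrite /taylor_at big_ord_recr/= derivD -/(taylor_at H y k.+1) IH derivZ.
rewrite derivM -derivnS deriv_exp/= derivB derivC derivX sub0r.
rewrite scalerDr addrA -[RHS]add0r; congr (_ + _).
have k0 : k.+1%:R != 0 :> R by rewrite pnatr_eq0.
have e : (k.+1%:R^-1)%:P * k.+1%:R = 1 :> {poly R}.
  by rewrite -polyC_natr -polyCM mulVf.
rewrite factS natrM invfM -!mul_polyC polyCM -[-1 * _ *+ k.+1]mulr_natr.
set P := (_ ^+ k); set D := (_^`()); set A := (k`!%:R^-1 : R)%:P.
move: e; set N := (k.+1%:R : {poly R}); set N' := (k.+1%:R^-1 : R)%:P => e.
transitivity (A * P * D * (1 - N' * N)); first by ring.
by rewrite e subrr mulr0.
Qed.

Lemma taylor_at_self H y k : (taylor_at H y k.+1).[y] = H.[y].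
Proof.
rewrite /taylor_at horner_sum big_ord_recl big1 => [|i _].
  by rewrite fact0 invr1 scale1r expr0 mul1r addr0 derivn0.
by rewrite lift0 hornerZ hornerM horner_exp !hornerE subrr exprS mul0r /= mulr0 mul0r.
Qed.

(** The same value with the base point [a] fixed, as a polynomial in [y]. *)
Definition taylor_poly H (a : R) (k : nat) : {poly R} :=
  \sum_(i < k) (i`!%:R^-1 * (H^`(i)).[a]) *: ('X - a%:P) ^+ i.

Lemma size_taylor_poly H a k : (size (taylor_poly H a k) <= k)%N.
Proof.
apply: (leq_trans (size_sum _ _ _)); apply/bigmax_leqP => i _.
by rewrite (leq_trans (size_scale_leq _ _))// size_exp_XsubC.
Qed.

Lemma taylor_polyE H a y k : (taylor_poly H a k).[y] = (taylor_at H y k).[a].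
Proof.
rewrite /taylor_at /taylor_poly !horner_sum; apply: eq_bigr => i _.
rewrite !hornerZ hornerM !horner_exp hornerXsubC hornerD hornerN hornerX hornerC.
by ring.
Qed.

Let kernel k y p u : R := truncpow k (y - u) / k`!%:R * p.[u].

(* The truncated power restricts the range of integration to u < y. *)
Let kernel_patch k y p : y <= 1 ->
  (EFin \o kernel k y p) \_ `[-1, 1] =
  (EFin \o horner (k`!%:R^-1 *: ((y%:P - 'X) ^+ k * p))) \_ `[-1, y[.
Proof.
move=> y1; apply/funext => u; rewrite !patchE !mem_setE !in_itv/=.
case: (leP (-1) u) => //= u0; case: (ltP u y) => [uy|yu].
- rewrite (ltW (lt_le_trans uy y1)) /kernel /truncpow subr_gt0 uy.
  rewrite hornerZ hornerM horner_exp hornerD hornerN hornerX hornerC.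
  by congr (_%:E); ring.
- by case: ifP => // _; rewrite /kernel /truncpow subr_gt0 ltNge yu/= !mul0r.
Qed.

Lemma integrable_truncpow k y p :
  mu.-integrable `[-1, 1] (fun u => (truncpow k (y - u) / k`!%:R * p.[u])%:E).
Proof.
set q := k`!%:R^-1 *: ((y%:P - 'X) ^+ k * p).
have [y1|y1] := leP y 1.
  apply/integrable_mkcond => //.
  rewrite -[fun u => _]/(EFin \o kernel k y p) kernel_patch//.
  apply: (iffLR (integrable_mkcond _ _)) => //.
  apply: (@integrableS _ _ _ mu `[-1, y]) => //; last exact: integrable_horner.
  by apply: subset_itvl; rewrite bnd_simp.
apply: eq_integrable (integrable_horner q (-1) 1) => //= u.
rewrite mem_setE in_itv/= => /andP[_ u1]; rewrite /q /truncpow subr_gt0.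
rewrite (le_lt_trans u1 y1) hornerZ hornerM horner_exp hornerD hornerN hornerX.
rewrite hornerC.
by congr (_%:E); ring.
Qed.

(** Taylor's formula with integral remainder. *)
Lemma integral_truncpow k y H : -1 <= y <= 1 ->
  (\int[mu]_(u in `[(-1)%R, 1%R]) (truncpow k (y - u) / k`!%:R * (H^`(k.+1)).[u])%:E =
   (H.[y] - (taylor_poly H (-1) k.+1).[y])%:E)%E.
Proof.
move=> /andP[y0 y1]; rewrite integral_mkcond.
rewrite -[LHS]/(integral mu setT ((EFin \o kernel k y H^`(k.+1)) \_ `[-1, 1])).
rewrite kernel_patch// -integral_mkcond.
rewrite integral_itv_bndo_bndc; last first.
  by apply/measurable_EFinP; exact: measurable_poly.
by rewrite -deriv_taylor_at integral_deriv_poly// taylor_at_self -taylor_polyE.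
Qed.

Let lagrange_dd_kernelE k s p u :
  (lagrange_dd s (fun y => truncpow k (y - u) / k`!%:R) * p.[u])%:E =
  (\sum_(y <- s) ((\prod_(z <- s | z != y) (y - z))^-1)%:E *
     (truncpow k (y - u) / k`!%:R * p.[u])%:E)%E.
Proof.
under eq_bigr do rewrite -EFinM.
rewrite sumEFin /lagrange_dd mulr_suml; congr (_%:E).
by apply: eq_bigr => y _; ring.
Qed.

Lemma integrable_lagrange_dd_truncpow k s p :
  mu.-integrable `[-1, 1] (fun u =>
    (lagrange_dd s (fun y => truncpow k (y - u) / k`!%:R) * p.[u])%:E).
Proof.
apply: eq_integrable => [//|u _|]; first by rewrite lagrange_dd_kernelE.
apply: integrable_sum => // y _; apply: integrableZl => //.
exact: integrable_truncpow.
Qed.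

(** Integrated against [H^`(k.+1)], the truncated powers give [H] up to a Taylor
    polynomial of degree at most [k], which divided differences of order [k.+1]
    do not see. *)
Lemma integral_lagrange_dd_truncpow k s H :
  uniq s -> size s = k.+2 -> {in s, forall y, -1 <= y <= 1} ->
  (\int[mu]_(u in `[(-1)%R, 1%R])
    (lagrange_dd s (fun y => truncpow k (y - u) / k`!%:R) * (H^`(k.+1)).[u])%:E =
  (lagrange_dd s (horner H))%:E)%E.
Proof.
move=> us ss s1; under eq_integral => u _ do rewrite lagrange_dd_kernelE.
rewrite integral_sum//; last first.
  by move=> y; apply: integrableZl => //; exact: integrable_truncpow.
rewrite (eq_big_seq (fun y => ((\prod_(z <- s | z != y) (y - z))^-1)%:E *
    (H.[y] - (taylor_poly H (-1)%R k.+1).[y])%:E)%E); last first.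
  move=> y ys; rewrite integralZl//; last exact: integrable_truncpow.
  by rewrite integral_truncpow// s1.
under eq_bigr do rewrite -EFinM.
rewrite sumEFin; congr (_%:E).
have <- : lagrange_dd s (fun y => H.[y] + (-1) * (taylor_poly H (-1) k.+1).[y]) =
    lagrange_dd s (horner H).
  rewrite lagrange_ddD lagrange_ddZ [X in _ + _ * X]lagrange_dd_poly//.
  - by rewrite ss/= nth_default ?mulr0 ?addr0// size_taylor_poly.
  - by rewrite ss.
  - by rewrite ss (leq_trans (size_taylor_poly _ _ _)).
by apply: eq_bigr => y _; ring.
Qed.

End PeanoKernel.

(** * Integration over the torus *)

Section IntegralMul.
Local Open Scope ereal_scope.
Context d1 d2 (T1 : measurableType d1) (T2 : measurableType d2) (R : realType).
Variables (m1 : {sigma_finite_measure set T1 -> \bar R})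
  (m2 : {sigma_finite_measure set T2 -> \bar R}).

Lemma integral_prod_mul (D1 : set T1) (D2 : set T2) (f : T1 -> R) (g : T2 -> R) :
  measurable D1 -> measurable D2 ->
  m1.-integrable D1 (EFin \o f) -> m2.-integrable D2 (EFin \o g) ->
  (m1 \x m2).-integrable (D1 `*` D2) (fun p => (f p.1 * g p.2)%:E) /\
  \int[m1 \x m2]_(p in D1 `*` D2) (f p.1 * g p.2)%:E =
  \int[m1]_(x in D1) (f x)%:E * \int[m2]_(y in D2) (g y)%:E.
Proof.
move=> mD1 mD2 intf intg.
pose F x : \bar R := ((EFin \o f) \_ D1) x.
pose G y : \bar R := ((EFin \o g) \_ D2) y.
have iF : m1.-integrable setT F by apply/(iffLR (integrable_mkcond _ mD1)).
have iG : m2.-integrable setT G by apply/(iffLR (integrable_mkcond _ mD2)).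
have FG p : ((fun p => (f p.1 * g p.2)%:E) \_ (D1 `*` D2)) p = F p.1 * G p.2.
  rewrite /F /G !patchE in_setX; case: (p.1 \in D1) => /=; last by rewrite mul0e.
  by case: (p.2 \in D2) => //=; rewrite mule0.
have mFG : measurable_fun setT (fun p : T1 * T2 => F p.1 * G p.2).
  apply: emeasurable_funM.
  - by apply: measurableT_comp => //; exact: measurable_int iF.
  - by apply: measurableT_comp => //; exact: measurable_int iG.
have Ffin x : F x \is a fin_num by rewrite /F patchE; case: ifP.
have mF : measurable_fun setT (fun x => `|F x|).
  by apply: measurableT_comp => //; exact: measurable_int iF.
have mG : measurable_fun setT (fun x => `|G x|).
  by apply: measurableT_comp => //; exact: measurable_int iG.
have iFG : (m1 \x m2).-integrable setT (fun p => F p.1 * G p.2).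
  apply/integrable12ltyP => //=.
  under eq_integral do under eq_integral do rewrite abseM.
  have E x : \int[m2]_y (`|F x| * `|G y|) = `|F x| * \int[m2]_y `|G y|.
    by rewrite ge0_integralZl.
  under eq_integral do rewrite E.
  rewrite ge0_integralZr//; last exact: integral_ge0.
  case/integrableP : iF => _ Foo; case/integrableP : iG => _ Goo.
  by rewrite lte_mul_pinfty ?integral_ge0// ge0_fin_numE ?integral_ge0.
split.
  apply/integrable_mkcond; first exact: measurableX.
  by apply: eq_integrable iFG => // p _; rewrite -FG.
rewrite integral_mkcond (eq_integral _ _ (fun p _ => FG p)).
rewrite -(integral12_prod_meas1 iFG) /fubini_F/=.
have Gint : \int[m2]_y G y \is a fin_num by exact: integrable_fin_num.
have E x : \int[m2]_y (F x * G y) = F x * (fine (\int[m2]_y G y))%:E.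
  by rewrite fineK// -[F x]fineK// integralZl.
under eq_integral do rewrite E.
by rewrite integralZr// fineK// -!integral_mkcond.
Qed.

End IntegralMul.

Section Torus.
Variable R : realType.
Let mu := @lebesgue_measure R.
Let lam d := lebesgue_tuple R d.

Lemma measurable_torus_box d : measurable (@torus_box R d).
Proof.
rewrite (_ : @torus_box R d =
  \bigcap_i (fun t : d.-tuple R => tnth t i) @^-1` `[0, 2 * pi]).
  apply: fin_bigcap_measurable => [|i _]; first exact: finite_finset.
  by rewrite -[X in measurable X]setTI; apply: (@measurable_tnth _ _ d i).
by apply/seteqP; split => t /= h i; [move=> _; exact: h|exact: (h i)].
Qed.

Lemma lebesgue_measure_period : mu `[0, 2 * pi] = (2 * pi)%:E.
Proof.
rewrite /mu lebesgue_measure_itv/= lte_fin mulr_gt0 ?pi_gt0//.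
by rewrite -EFinB subr0.
Qed.

Lemma lebesgue_tuple_torus_box d : lam d (@torus_box R d) = ((2 * pi) ^+ d)%:E.
Proof.
have -> : @torus_box R d = [set t | forall i, [set` `[0, 2 * pi]] (tnth t i)] by [].
rewrite /lam (@lebesgue_tuple_box _ _ (fun=> [set` `[0, 2 * pi]]))//.
rewrite (eq_bigr (fun=> (2 * pi)%:E)); last first.
  by move=> i _; exact: lebesgue_measure_period.
by rewrite big_const card_ord; elim: d => //= d ->; rewrite exprS EFinM.
Qed.

Lemma preimage_cons_torus_box d : @cons_pair R d @^-1` @torus_box R d.+1 =
  `[0, 2 * pi] `*` @torus_box R d.
Proof.
apply/seteqP; split=> [[x th] h|[x th] [hx hth]] /=.
  by split=> [|i] /=; [exact: (h ord0)|have := h (lift ord0 i); rewrite tnthS].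
by move=> i; case: (unliftP ord0 i) => [j ->|->//]; rewrite tnthS; exact: hth.
Qed.

(** The Borel structure that carries the Lebesgue measure and the one of the
    entries of tuples have the same measurable sets but different displays. *)
Lemma measurable_cons_pair_lebesgue d : measurable_fun setT
  (@cons_pair R d : (measurableTypeR R * d.-tuple R)%type -> d.+1.-tuple R).
Proof. exact: measurable_cons_pair. Qed.

(** The measure on tuples is the image of a product measure under [cons_pair]. *)
Lemma integral_lebesgue_tupleS d (f : d.+1.-tuple R -> R) :
  measurable_fun setT f ->
  (mu \x lam d)%E.-integrable (`[0, 2 * pi] `*` @torus_box R d)
    (fun p => (f (cons_pair p))%:E) ->
  (lam d.+1).-integrable (@torus_box R d.+1) (EFin \o f) /\
  (\int[lam d.+1]_(t in @torus_box R d.+1) (f t)%:E =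
   \int[mu \x lam d]_(p in `[0%R, (2 * pi)%R] `*` @torus_box R d)
     (f (cons_pair p))%:E)%E.
Proof.
move=> mf intf.
have mEf : measurable_fun setT (EFin \o f) by exact/measurable_EFinP.
have mbox := measurable_torus_box.
split; last first.
  rewrite -preimage_cons_torus_box in intf *.
  exact: (integral_pushforward (@measurable_cons_pair_lebesgue d) mEf intf (mbox _)).
apply/integrableP; split; first exact: measurable_funTS.
have mabs : measurable_fun (@torus_box R d.+1) (fun t => `|(f t)%:E|%E).
  by apply: measurable_funTS; exact: measurableT_comp.
have := ge0_integral_pushforward (@measurable_cons_pair_lebesgue d) (mu \x lam d)%E
  (mbox _) mabs (fun _ _ => abse_ge0 _).
rewrite /= => E; rewrite [X in (X < _)%E]E preimage_cons_torus_box.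
by move/integrableP : intf => [].
Qed.

Let continuous_cos_freq (a : R) : continuous (fun t => cos (a * t)).
Proof.
move=> x; apply: continuous_comp; last exact: continuous_cos.
exact: mulrl_continuous.
Qed.

Lemma measurable_dirichlet_term k : measurable_fun setT (@dirichlet_term R k).
Proof.
rewrite /dirichlet_term; case: eqP => _; first exact: measurable_cst.
apply: measurable_funM; first exact: measurable_cst.
by apply: continuous_measurable_fun; exact: continuous_cos_freq.
Qed.

Lemma dirichlet_term_le0 k (t : R) : `|dirichlet_term k t| <= dirichlet_term k 0.
Proof.
rewrite /dirichlet_term; case: eqP => _; first by rewrite normr1.
by rewrite mulr0 cos0 mulr1 normrM ger0_norm// ler_piMr// cos_max.
Qed.

Lemma integrable_dirichlet_termM k l : mu.-integrable `[0, 2 * pi]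
  (EFin \o (fun t => dirichlet_term k t * dirichlet_term l t)).
Proof.
apply: measurable_bounded_integrable => //.
- by rewrite [X in (X < _)%E]lebesgue_measure_period ltry.
- apply: measurable_funTS; apply: measurable_funM; exact: measurable_dirichlet_term.
- exists (dirichlet_term k 0 * dirichlet_term l 0).
  split=> [|B ltB t _ /=]; first exact: num_real.
  apply/ltW/(le_lt_trans _ ltB); rewrite normrM.
  by apply: ler_pM => //; exact: dirichlet_term_le0.
Qed.

Lemma integral_cos_freq k : (0 < k)%N ->
  (\int[mu]_(t in `[0%R, (2 * pi)%R]) (cos (k%:R * t))%:E = 0)%E.
Proof.
move=> k0; have kn0 : k%:R != 0 :> R by rewrite pnatr_eq0 -lt0n.
have pi2 : 0 < 2 * pi :> R by rewrite mulr_gt0// pi_gt0.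
pose F (t : R) := k%:R^-1 * sin (k%:R * t).
have dF (x : R) : is_derive x 1 F (cos (k%:R * x)).
  by apply: is_derive_eq; rewrite /GRing.scale/= mulr1 mulrCA mulVf// mulr1.
have cF : continuous F.
  by move=> x; apply/differentiable_continuous/derivable1_diffP; exact: ex_derive.
have E : sin (k%:R * (2 * pi)) = sin 0 :> R.
  have := periodicn (@sinD2pi R) k 0; rewrite add0r => <-; congr sin.
  by rewrite !mulr_natl.
rewrite (@continuous_FTC2 _ _ F)//.
- by rewrite /F E mulr0 -EFinB subrr.
- exact/continuous_subspaceT/continuous_cos_freq.
- split => [x _||].
  + exact: ex_derive.
  + by apply: cvg_at_right_filter; exact: cF.
  + by apply: cvg_at_left_filter; exact: cF.
- by move=> x _; rewrite derive1E; exact: derive_val.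
Qed.

Lemma integral_dirichlet_term k :
  (\int[mu]_(t in `[0%R, (2 * pi)%R]) (dirichlet_term k t)%:E =
   (if k == 0%N then 2 * pi else 0)%:E)%E.
Proof.
rewrite /dirichlet_term; case: eqP => k0.
  by rewrite integral_cst// mul1e; exact: lebesgue_measure_period.
under eq_integral do rewrite EFinM.
rewrite integralZl//; last first.
  apply: continuous_compact_integrable; first exact: segment_compact.
  exact/continuous_subspaceT/continuous_cos_freq.
by rewrite integral_cos_freq ?mule0// lt0n; apply/eqP.
Qed.

(** The product-to-sum formula for cosines. *)
Lemma dirichlet_termM k l (t : R) : (k <= l)%N ->
  dirichlet_term k t * dirichlet_term l t =
  if k == 0%N then dirichlet_term l t else
  dirichlet_term (l + k) t + (if k == l then 2 else 1) * dirichlet_term (l - k) t.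
Proof.
move=> kl; rewrite /dirichlet_term; case: eqP => k0; first by rewrite mul1r.
have -> : (l == 0)%N = false by lia.
have -> : (l + k == 0)%N = false by lia.
have P : 2 * cos (l%:R * t) * cos (k%:R * t) =
    cos ((l + k)%:R * t) + cos ((l - k)%:R * t).
  by rewrite natrB// natrD [(_ + k%:R) * t]mulrDl mulrBl cosD cosB; ring.
have [E|kl'] := eqVneq k l.
  rewrite -E subnn mul0r cos0 in P *.
  transitivity (2 * (2 * cos (k%:R * t) * cos (k%:R * t))); first by ring.
  by rewrite P mulrDr.
rewrite subn_eq0 leqNgt ltn_neqAle kl' kl/= mul1r -mulrDr -P; ring.
Qed.

Lemma integral_dirichlet_termM k l :
  (\int[mu]_(t in `[0%R, (2 * pi)%R]) (dirichlet_term k t * dirichlet_term l t)%:E =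
   (if k == l then 2 * pi * dirichlet_term k 0 else 0)%:E)%E.
Proof.
wlog kl : k l / (k <= l)%N.
  move=> H; case: (leqP k l) => [|/ltnW lk]; first exact: H.
  under eq_integral do rewrite mulrC.
  by rewrite H// eq_sym; case: eqP => // ->.
have int m : mu.-integrable `[0, 2 * pi] (fun t => (dirichlet_term m t)%:E).
  have := integrable_dirichlet_termM 0 m.
  by apply: eq_integrable => // t _; rewrite /= mul1r.
under eq_integral do rewrite dirichlet_termM//.
have [->|k0] := eqVneq k 0%N.
  by rewrite integral_dirichlet_term eq_sym; case: eqP => // _; rewrite mulr1.
under eq_integral do rewrite EFinD EFinM.
rewrite integralD//; last exact: integrableZl.
rewrite integralZl//.
rewrite !integral_dirichlet_term addn_eq0 (negPf k0) andbF add0e.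
rewrite subn_eq0 -EFinM; congr (_%:E).
have [E|kl'] := eqVneq k l; last by rewrite leqNgt ltn_neqAle kl' kl mulr0.
by rewrite -E leqnn /dirichlet_term (negPf k0) mulr0 cos0 mulr1 mulrC.
Qed.

End Torus.

(** * Orthogonality of Dirichlet sums *)

Section Orthogonality.
Variable R : realType.
Let mu := @lebesgue_measure R.
Let lam d := lebesgue_tuple R d.

Lemma measurable_dirichlet_sum d n :
  measurable_fun setT (fun th : d.-tuple R => dirichlet_sum th n).
Proof.
elim: d n => [|d IH] n.
  rewrite (_ : (fun _ => _) = cst (n == 0)%:R); first exact: measurable_cst.
  by apply/funext => th; rewrite tuple0.
rewrite (_ : (fun _ => _) = (fun th : d.+1.-tuple R => \sum_(k < n.+1)
    dirichlet_term k (tnth th ord0) * dirichlet_sum [tuple of behead th] (n - k))).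
  apply: measurable_sum => k; apply: measurable_funM.
  - apply: measurableT_comp; first exact: measurable_dirichlet_term.
    exact: measurable_tnth.
  - apply: (measurableT_comp (f := fun th : d.-tuple R => dirichlet_sum th (n - k))).
      exact: IH.
    exact: measurable_behead.
apply/funext => th; case/tupleP: th => t th.
rewrite dirichlet_sum_cons tnth0; apply: eq_bigr => k _.
by congr (_ * dirichlet_sum _ _).
Qed.

Lemma dirichlet_sum_le0 (th : seq R) n :
  `|dirichlet_sum th n| <= dirichlet_sum (nseq (size th) 0) n.
Proof.
elim: th n => [|t th IH] n /=; first by rewrite ger0_norm.
apply: (le_trans (ler_norm_sum _ _ _)); apply: ler_sum => k _.
by rewrite normrM ler_pM// dirichlet_term_le0.
Qed.

Lemma integrable_bounded_torus d (f : d.-tuple R -> R) (M : R) :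
  measurable_fun setT f -> (forall th, `|f th| <= M) ->
  (lam d).-integrable (@torus_box R d) (EFin \o f).
Proof.
move=> mf fM; apply: measurable_bounded_integrable.
- exact: measurable_torus_box.
- by rewrite [X in (X < _)%E]lebesgue_tuple_torus_box ltry.
- exact: measurable_funTS.
- exists M; split=> [|K MK th _ /=]; first exact: num_real.
  exact/ltW/(le_lt_trans _ MK).
Qed.

Lemma integrable_dirichlet_sumM d n n' : (lam d).-integrable (@torus_box R d)
  (EFin \o (fun th => dirichlet_sum th n * dirichlet_sum th n')).
Proof.
apply: (@integrable_bounded_torus _ _
  (dirichlet_sum (nseq d 0) n * dirichlet_sum (nseq d 0) n')).
  by apply: measurable_funM; exact: measurable_dirichlet_sum.
have B k (th : d.-tuple R) : `|dirichlet_sum th k| <= dirichlet_sum (nseq d 0) k.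
  by have := dirichlet_sum_le0 th k; rewrite size_tuple.
by move=> th; rewrite normrM; apply: ler_pM.
Qed.

(** Orthogonality of the one-dimensional factors makes only equal splittings of
    [n] and [n'] contribute, and their contributions add up by the same
    convolution as the values of the Dirichlet sums at the origin. *)
Lemma integral_dirichlet_sumM d n n' :
  (\int[lam d]_(th in @torus_box R d) (dirichlet_sum th n * dirichlet_sum th n')%:E =
   (if n == n' then (2 * pi) ^+ d * dirichlet_sum (nseq d 0) n else 0)%:E)%E.
Proof.
elim: d n n' => [|d IH] n n'.
  have mf : measurable_fun (@torus_box R 0)
      (fun th : 0.-tuple R => (dirichlet_sum th n * dirichlet_sum th n')%:E).
    apply: measurable_funTS; apply/measurable_EFinP; apply: measurable_funM;
      exact: measurable_dirichlet_sum.
  rewrite /lam [LHS]integral_dirac//; last exact: measurable_torus_box.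
  rewrite diracE mem_set ?mul1e; last by case.
  rewrite /= expr0 mul1r; congr (_%:E).
  by clear mf; case: n n' => [|n] [|n'] /=; rewrite ?mul0r ?mulr0 ?mul1r//; case: ifP.
pose cc k l (t : R) := dirichlet_term k t * dirichlet_term l t.
pose gg k l (th : d.-tuple R) := dirichlet_sum th k * dirichlet_sum th l.
have prod k l := @integral_prod_mul _ _ _ _ _ (@lebesgue_measure R) (lam d)
  `[0, 2 * pi] (@torus_box R d) (cc k l) (gg (n - k)%N (n' - l)%N)
  (measurable_itv _) (@measurable_torus_box R d)
  (integrable_dirichlet_termM R k l) (integrable_dirichlet_sumM d (n - k) (n' - l)).
have fE (p : R * d.-tuple R) :
    (dirichlet_sum (cons_pair p) n * dirichlet_sum (cons_pair p) n')%:E =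
    (\sum_(k < n.+1) \sum_(l < n'.+1)
      (cc k l p.1 * gg (n - k)%N (n' - l)%N p.2)%:E)%E.
  rewrite /cons_pair !dirichlet_sum_cons big_distrlr/= -sumEFin.
  apply: eq_bigr => k _; rewrite -sumEFin; apply: eq_bigr => l _.
  by congr (_%:E); rewrite /cc /gg; ring.
have mf : measurable_fun setT (fun th : d.+1.-tuple R =>
    dirichlet_sum th n * dirichlet_sum th n').
  by apply: measurable_funM; exact: measurable_dirichlet_sum.
have iprod : (mu \x lam d)%E.-integrable (`[0, 2 * pi] `*` @torus_box R d)
    (fun p => (dirichlet_sum (cons_pair p) n * dirichlet_sum (cons_pair p) n')%:E).
  apply: eq_integrable => [|p _|].
  - exact: measurableX (@measurable_torus_box R d).
  - by rewrite fE.
  - apply: integrable_sum => [|k _].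
      exact: measurableX (@measurable_torus_box R d).
    apply: integrable_sum => [|l _]; last by have [] := prod k l.
    exact: measurableX (@measurable_torus_box R d).
rewrite (integral_lebesgue_tupleS mf iprod).2.
under eq_integral do rewrite fE.
rewrite integral_sum; [|exact: measurableX (@measurable_torus_box R d)|]; last first.
  move=> k; apply: integrable_sum => [|l _]; last by have [] := prod k l.
  exact: measurableX (@measurable_torus_box R d).
transitivity (\sum_(k < n.+1) \sum_(l < n'.+1)
    ((if k == l :> nat then 2 * pi * dirichlet_term k 0 else 0) *
     (if (n - k == n' - l)%N then (2 * pi) ^+ d * dirichlet_sum (nseq d 0) (n - k)
      else 0) : R)%:E)%E.
  apply: eq_bigr => k _.
  rewrite integral_sum; [|exact: measurableX (@measurable_torus_box R d)|]; last first.
    by move=> l; have [] := prod k l.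
  apply: eq_bigr => l _; have [_ ->] := prod k l.
  by rewrite integral_dirichlet_termM IH EFinM.
under eq_bigr do rewrite sumEFin.
rewrite sumEFin; congr (_%:E).
have [<-|nn'] := eqVneq n n'; last first.
  apply: big1 => k _; apply: big1 => l _; case: eqP => [kl|]; last by rewrite mul0r.
  case: eqP => nk; last by rewrite mulr0.
  by have := ltn_ord k; have := ltn_ord l; lia.
rewrite dirichlet_sum_cons mulr_sumr; apply: eq_bigr => k _.
rewrite (bigD1 k)//= !eqxx big1 ?addr0.
  by rewrite exprS; ring.
by move=> l /negPf lk; rewrite -[(k : nat) == l]/(k == l) eq_sym lk mul0r.
Qed.

End Orthogonality.

(** * Angles with coinciding cosines *)

Section CoincidingCosines.
Variable R : realType.
Let mu := @lebesgue_measure R.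
Let lam d := lebesgue_tuple R d.

Lemma measurable_cos_fun d (T : measurableType d) (f : T -> R) :
  measurable_fun setT f -> measurable_fun setT (fun t => cos (f t)).
Proof.
move=> mf; apply: (measurableT_comp (f := @cos R)) => //.
by apply: continuous_measurable_fun; exact: continuous_cos.
Qed.

Lemma measurable_mem_map_cos d (T : measurableType d) m (f : T -> R)
    (g : T -> m.-tuple R) :
  measurable_fun setT f -> measurable_fun setT g ->
  measurable_fun setT (fun t => f t \in map (@cos R) (g t)).
Proof.
move=> mf; elim: m g => [|m IH] g mg.
  rewrite (_ : (fun _ => _) = cst false); first exact: measurable_cst.
  by apply/funext => t; rewrite tuple0.
rewrite (_ : (fun _ => _) = (fun t => (f t == cos (tnth (g t) ord0)) ||
    (f t \in map (@cos R) [tuple of behead (g t)]))).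
  apply: measurable_or.
  - apply: measurable_fun_eqr => //; apply: measurable_cos_fun.
    apply: (measurableT_comp (f := fun t : m.+1.-tuple R => tnth t ord0)) => //.
    exact: measurable_tnth.
  - apply: IH.
    apply: (measurableT_comp (f := fun t : m.+1.-tuple R => [tuple of behead t])) => //.
    exact: measurable_behead.
apply/funext => t; case/tupleP: (g t) => x th.
by rewrite /= inE tnth0.
Qed.

Lemma measurable_uniq_map_cos d :
  measurable_fun setT (fun th : d.-tuple R => uniq (map (@cos R) th)).
Proof.
elim: d => [|d IH].
  rewrite (_ : (fun _ => _) = cst true); first exact: measurable_cst.
  by apply/funext => th; rewrite tuple0.
rewrite (_ : (fun _ => _) = (fun th : d.+1.-tuple R =>
    ~~ (cos (tnth th ord0) \in map (@cos R) [tuple of behead th]) &&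
    uniq (map (@cos R) [tuple of behead th]))).
  apply: measurable_and.
  - apply: measurable_neg; apply: measurable_mem_map_cos.
      by apply: measurable_cos_fun; exact: measurable_tnth.
    exact: measurable_behead.
  - apply: (measurableT_comp (f := fun th : d.-tuple R => uniq (map (@cos R) th))) => //.
    exact: measurable_behead.
apply/funext => th; case/tupleP: th => x th.
by rewrite /= tnth0.
Qed.

Definition coinciding_cos d : set (d.-tuple R) :=
  @torus_box R d `&` [set th | ~~ uniq (map (@cos R) th)].

Lemma measurable_coinciding_cos d : measurable (@coinciding_cos d).
Proof.
apply: measurableI; first exact: measurable_torus_box.
have := @measurable_uniq_map_cos d measurableT [set false] I.
rewrite setTI; congr measurable; apply/seteqP; split => th /=; last by move/negPf.
by move=> ->.
Qed.

Lemma cos_fiber (c x : R) : x \in `[0, 2 * pi] -> cos x = c ->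
  x = acos c \/ x = 2 * pi - acos c.
Proof.
rewrite in_itv/= => /andP[x0 x2] <-; have [xpi|pix] := leP x pi.
  by left; rewrite cosK// in_itv/= x0.
right; suff -> : acos (cos x) = 2 * pi - x by rewrite opprB addrC subrK.
have -> : cos x = cos (2 * pi - x).
  by rewrite -[RHS]cosN opprB -[RHS]cosD2pi mulr_natl subrK.
by rewrite cosK// in_itv/=; apply/andP; split; lra.
Qed.

Lemma countable_cos_mem (s : seq R) :
  countable [set x | x \in `[0, 2 * pi] /\ cos x \in s].
Proof.
apply: finite_set_countable.
apply: (@sub_finite_set _ _
  [set` [seq acos c | c <- s] ++ [seq 2 * pi - acos c | c <- s]]).
  move=> x /= [xI xs]; rewrite mem_cat; have [E|E] := cos_fiber xI erefl.
  - by apply/orP; left; rewrite {1}E map_f.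
  - by apply/orP; right; rewrite {1}E (map_f (fun c => 2 * pi - acos c)).
exact: finite_seq.
Qed.

(** Given pairwise distinct cosines of the other angles, the first angle has to
    avoid finitely many values only. *)
Lemma lebesgue_tuple_coinciding_cos d : lam d (@coinciding_cos d) = 0%E.
Proof.
elim: d => [|d IH].
  rewrite (_ : @coinciding_cos 0 = set0) ?measure0//.
  by apply/seteqP; split=> // th [_]/=; rewrite tuple0.
pose B := @cons_pair R d @^-1` (@coinciding_cos d.+1).
have mB : measurable (B : set (measurableTypeR R * d.-tuple R)%type).
  rewrite -[B]setTI; apply: (@measurable_cons_pair_lebesgue R d) => //.
  exact: measurable_coinciding_cos.
have mI : measurable_fun setT (\1_B : (measurableTypeR R * d.-tuple R)%type -> R).
  exact: measurable_indic.
have mF : measurable_fun setT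
    (EFin \o (\1_B : (measurableTypeR R * d.-tuple R)%type -> R)).
  exact/measurable_EFinP.
rewrite -[LHS]/((mu \x lam d)%E B) -[B]setIT -integral_indic// fubini_tonelli2//.
transitivity (\int[lam d]_th (cst 0 th))%E; last exact: integral0.
apply: ge0_ae_eq_integral => //.
- by apply: measurable_fun_fubini_tonelli_G => // p; rewrite lee_fin.
- by move=> th _; apply: integral_ge0 => x _; rewrite lee_fin.
exists (@coinciding_cos d); split => //; first exact: measurable_coinciding_cos.
move=> th /= /not_implyP[_ nz]; apply/not_notP => nth; apply: nz.
rewrite /fubini_G/=.
have mS : measurable ([set x | B (x, th)] : set (measurableTypeR R)).
  have := measurable_ysection th mB; congr measurable.
  by apply/seteqP; split=> x; rewrite /ysection/= => ?; [exact: set_mem|exact: mem_set].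
transitivity (mu [set x | B (x, th)]).
  transitivity (\int[@lebesgue_measure R]_x (\1_[set x | B (x, th)] x)%:E)%E;
    last first.
    by rewrite integral_indic// setIT.
  apply: eq_integral => x _.
  by rewrite !indicE; congr (_%:R%:E).
apply: countable_lebesgue_measure0.
apply: sub_countable (countable_cos_mem (map (@cos R) th)); apply: subset_card_le.
move=> x [hbox]; rewrite /= negb_and negbK => /orP[cx|uth].
  by split=> //; exact: (hbox ord0).
exfalso; apply: nth; split=> // i.
by have := hbox (lift ord0 i); rewrite tnthS.
Qed.

Lemma ae_uniq_map_cos d :
  {ae lam d, forall th, @torus_box R d th -> uniq (map (@cos R) th)}.
Proof.
exists (@coinciding_cos d); split.
- exact: measurable_coinciding_cos.
- exact: lebesgue_tuple_coinciding_cos.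
- by move=> th /= /not_implyP[hb /negP].
Qed.

End CoincidingCosines.

(** * The B-spline with knots at cosines *)

Section Bspline.
Variable R : realType.
Let mu := @lebesgue_measure R.

Lemma measurable_invr : measurable_fun setT (@GRing.inv R).
Proof.
(* The first factor takes care of x = 0, where the inverse is zero. *)
rewrite (_ : GRing.inv = fun x : R => x * (x ^+ 2) `^ (-1)); last first.
  apply/funext => x; have [->|x0] := eqVneq x 0; first by rewrite invr0 mul0r.
  rewrite powR_inv1 ?sqr_ge0//.
  by rewrite expr2 invfM mulVKf.
apply: measurable_funM => //.
apply: (measurableT_comp (f := fun x : R => x `^ (-1))); first exact: measurable_powR.
exact: exprn_measurable.
Qed.

Lemma measurable_divdiff d (T : measurableType d) (f : T -> R -> R) m
    (x : nat -> T -> R) :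
  (forall i, measurable_fun setT (x i)) ->
  (forall i, measurable_fun setT (fun t => f t (x i t))) ->
  measurable_fun setT (fun t => divdiff (f t) m (fun i => x i t)).
Proof.
elim: m x => [|m IH] x mx mf /=; first exact: mf.
apply: measurable_funM; first by apply: measurable_funB; exact: IH.
apply: (measurableT_comp (f := @GRing.inv R)); first exact: measurable_invr.
by apply: measurable_funB.
Qed.

Lemma measurable_truncpow d (T : measurableType d) k (f : T -> R) :
  measurable_fun setT f -> measurable_fun setT (fun t => truncpow k (f t)).
Proof.
move=> mf; rewrite /truncpow; apply: measurable_fun_ifT.
- by apply: measurable_fun_ltr => //; exact: measurable_cst.
- exact: measurable_funX.
- exact: measurable_cst.
Qed.

Lemma measurable_cos_nth d i :
  measurable_fun setT (fun th : d.-tuple R => cos (nth 0 th i)).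
Proof.
apply: measurable_cos_fun; have [id|di] := ltnP i d.
  rewrite (_ : (fun _ => _) = (@tnth _ R ^~ (Ordinal id))).
    exact: measurable_tnth.
  by apply/funext => th; rewrite (tnth_nth 0).
rewrite (_ : (fun _ => _) = cst 0); first exact: measurable_cst.
by apply/funext => th; rewrite nth_default// size_tuple.
Qed.

(* The exponent d - 2 of the truncated power is called k. *)
Variable k : nat.
Let d := k.+2.
Let lam := lebesgue_tuple R d.
Let M (u : R) (th : d.-tuple R) := Bspline d.-1 u (fun i => cos (nth 0 th i)).
Let D : set (measurableTypeR R * d.-tuple R) := `[-1, 1] `*` @torus_box R d.

Lemma measurable_Bspline_cos :
  measurable_fun setT (fun p : (measurableTypeR R * d.-tuple R)%type => M p.1 p.2).
Proof.
have := @measurable_divdiff _ (measurableTypeR R * d.-tuple R)%type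
  (fun p y => truncpow k (y - p.1) / k`!%:R) d.-1 (fun i p => cos (nth 0 p.2 i)).
apply => i.
  exact: (measurableT_comp (@measurable_cos_nth d i) measurable_snd).
apply: measurable_funM; last exact: measurable_cst.
apply: measurable_truncpow; apply: measurable_funB; last exact: measurable_fst.
exact: (measurableT_comp (@measurable_cos_nth d i) measurable_snd).
Qed.

Lemma BsplineE (th : d.-tuple R) u : uniq (map (@cos R) th) ->
  M u th = lagrange_dd (map (@cos R) th) (fun y => truncpow k (y - u) / k`!%:R).
Proof.
have E : mkseq (fun i => cos (nth 0 th i)) d.-1.+1 = map (@cos R) th.
  rewrite -[in RHS](mkseq_nth 0 th) size_tuple -map_comp.
  by apply: eq_map.
by move=> uth; rewrite /M /Bspline divdiffE E.
Qed.

Lemma Bspline_ge0 (th : d.-tuple R) u : uniq (map (@cos R) th) -> 0 <= M u th.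
Proof.
move=> uth; rewrite BsplineE//.
rewrite (@eq_lagrange_dd _ _ _ (fun y => k`!%:R^-1 * truncpow k (y - u))); last first.
  by move=> y _; rewrite mulrC.
by rewrite lagrange_ddZ mulr_ge0// lagrange_dd_truncpow_ge0// size_map size_tuple.
Qed.

Let cos_itv (th : d.-tuple R) : {in map (@cos R) th, forall y, -1 <= y <= 1}.
Proof. by move=> y /mapP[t _ ->]; rewrite cos_geN1 cos_le1. Qed.

Lemma integrable_Bspline_section (th : d.-tuple R) (p : {poly R}) :
  uniq (map (@cos R) th) ->
  mu.-integrable `[-1, 1] (fun u => (M u th * p.[u])%:E).
Proof.
move=> uth.
apply: eq_integrable (integrable_lagrange_dd_truncpow k (map (@cos R) th) p) => //.
by move=> u _; rewrite BsplineE.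
Qed.

(** The B-spline is the Peano kernel of the divided difference. *)
Lemma integral_Bspline (th : d.-tuple R) (H : {poly R}) : uniq (map (@cos R) th) ->
  (\int[mu]_(u in `[(-1)%R, 1%R]) (M u th * (H^`(k.+1)).[u])%:E =
   (lagrange_dd (map (@cos R) th) (horner H))%:E)%E.
Proof.
move=> uth; rewrite -(@integral_lagrange_dd_truncpow _ k)// ?size_map ?size_tuple//.
by apply: eq_integral => u _; rewrite BsplineE.
Qed.

Lemma integral_Bspline1 (th : d.-tuple R) : uniq (map (@cos R) th) ->
  (\int[mu]_(u in `[(-1)%R, 1%R]) (M u th)%:E = (k.+1`!%:R^-1)%:E)%E.
Proof.
move=> uth; pose H : {poly R} := k.+1`!%:R^-1 *: 'X^(k.+1).
have H1 : H^`(k.+1) = 1.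
  rewrite /H derivnZ derivnXn subnn ffactnn expr0 -scalerMnr scalerMnl.
  by rewrite -[_^-1 *+ _]mulr_natr mulVf ?scale1r.
have := integral_Bspline H uth; rewrite H1.
under eq_integral do rewrite hornerC mulr1.
move=> ->; rewrite lagrange_dd_poly ?size_map ?size_tuple//.
  by rewrite /H coefZ coefXn eqxx mulr1.
by rewrite (leq_trans (size_scale_leq _ _))// size_polyXn.
Qed.

(** The B-spline is unbounded, but it is nonnegative for almost all angles and
    its integral in [u] does not depend on the angles, so that Tonelli's theorem
    applies. *)
Lemma integrable_Bspline : (mu \x lam)%E.-integrable D (fun p => (M p.1 p.2)%:E).
Proof.
have mD : measurable D by exact: measurableX (@measurable_torus_box R d).
have mM : measurable_fun setT
    (fun p : (measurableTypeR R * d.-tuple R)%type => (M p.1 p.2)%:E).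
  by apply/measurable_EFinP; exact: measurable_Bspline_cos.
apply/integrable_mkcond => //.
set F := (X in _.-integrable _ X).
have mF : measurable_fun setT F.
  by apply/(measurable_restrictT _ mD); apply: measurable_funTS.
apply/integrable21ltyP => //.
pose C : R := k.+1`!%:R^-1.
apply: (@le_lt_trans _ _ (\int[lam]_th (((cst C%:E) \_ (@torus_box R d)) th))%E).
  apply: ae_ge0_le_integral => //.
  - by move=> th _; exact: integral_ge0.
  - apply: (measurable_fun_fubini_tonelli_G (abse \o F)) => //=.
    exact: measurableT_comp.
  - by move=> th _; rewrite patchE; case: ifP => // _; rewrite lee_fin invr_ge0.
  - apply/(measurable_restrictT _ (@measurable_torus_box R d)).
    exact: measurable_cst.
  - apply: filterS (@ae_uniq_map_cos R d) => th uth _.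
    rewrite patchE; case: ifPn => [|/negP] hth.
      have {}hth := set_mem hth; rewrite -(integral_Bspline1 (uth hth)).
      rewrite [leRHS]integral_mkcond le_eqVlt; apply/orP; left; apply/eqP.
      apply: eq_integral => u _; rewrite /F !patchE in_setX [th \in _]mem_set// andbT.
      case: ifPn => _; last by rewrite abse0.
      by rewrite gee0_abs// lee_fin Bspline_ge0// uth.
    rewrite (eq_integral (cst 0%E)) ?integral0// => u _.
    rewrite /F patchE in_setX; case: (boolP (th \in @torus_box R d)) => [/hth//|_].
    by rewrite andbF abse0.
rewrite -integral_mkcond integral_cst; last exact: measurable_torus_box.
by rewrite [X in (_ * X)%E]lebesgue_tuple_torus_box -EFinM ltry.
Qed.

Lemma integrable_BsplineM (h : R -> d.-tuple R -> R) :
  measurable_fun setT (fun p : (measurableTypeR R * d.-tuple R)%type => h p.1 p.2) ->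
  (exists B, forall u th, -1 <= u <= 1 -> `|h u th| <= B) ->
  (mu \x lam)%E.-integrable D (fun p => (M p.1 p.2 * h p.1 p.2)%:E).
Proof.
move=> mh [B hB].
have mD : measurable D by exact: measurableX (@measurable_torus_box R d).
apply: eq_integrable (integrableMl mD integrable_Bspline (measurable_funTS mh) _) => //.
exists B; split=> [|K BK [u th] [/= hu _]]; first exact: num_real.
by apply: (le_trans _ (ltW BK)); apply: hB; move: hu; rewrite in_itv.
Qed.

End Bspline.

(** * Biorthogonality *)

Section FubiniRect.
Local Open Scope ereal_scope.
Context d1 d2 (T1 : measurableType d1) (T2 : measurableType d2) (R : realType).
Variables (m1 : {sigma_finite_measure set T1 -> \bar R})
  (m2 : {sigma_finite_measure set T2 -> \bar R}).

(** Infinite values are replaced by zero, which does not increase the absolute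
    value. *)
Lemma integrable_fine d (T : measurableType d) (m : {measure set T -> \bar R})
    (D : set T) (f : T -> \bar R) : measurable D ->
  m.-integrable D f -> m.-integrable D (fun x => (fine (f x))%:E).
Proof.
move=> mD intf; apply: le_integrable (intf) => //.
  apply/measurable_EFinP; apply: measurableT_comp => //.
  exact: measurable_int intf.
by move=> x _; case: (f x) => [r||] //=; rewrite normr0 leey.
Qed.

Lemma fubini_rect (D1 : set T1) (D2 : set T2) (f : T1 -> T2 -> R) :
  measurable D1 -> measurable D2 ->
  (m1 \x m2).-integrable (D1 `*` D2) (fun p => (f p.1 p.2)%:E) ->
  [/\ {ae m1, forall x, D1 x -> m2.-integrable D2 (fun y => (f x y)%:E)},
      m1.-integrable D1 (fun x => \int[m2]_(y in D2) (f x y)%:E),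
      measurable_fun D2 (fun y => \int[m1]_(x in D1) (f x y)%:E) &
      \int[m1]_(x in D1) \int[m2]_(y in D2) (f x y)%:E =
      \int[m2]_(y in D2) \int[m1]_(x in D1) (f x y)%:E].
Proof.
move=> mD1 mD2 intf.
have mD : measurable (D1 `*` D2) by exact: measurableX.
pose F := (fun p : T1 * T2 => (f p.1 p.2)%:E) \_ (D1 `*` D2).
have iF : (m1 \x m2).-integrable setT F by apply/(iffLR (integrable_mkcond _ mD)).
have F1 x : D1 x -> (fun y => F (x, y)) = (fun y => (f x y)%:E) \_ D2.
  by move=> Dx; apply/funext => y; rewrite /F !patchE in_setX mem_set.
have F2 y : D2 y -> (fun x => F (x, y)) = (fun x => (f x y)%:E) \_ D1.
  by move=> Dy; apply/funext => x; rewrite /F !patchE in_setX [y \in _]mem_set// andbT.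
have E1 : fubini_F m2 F = (fun x => \int[m2]_(y in D2) (f x y)%:E) \_ D1.
  apply/funext => x; rewrite /fubini_F patchE; case: ifPn => [/set_mem Dx|nDx].
    by rewrite F1// -integral_mkcond.
  by apply: integral0_eq => y _; rewrite /F patchE in_setX (negPf nDx).
have E2 : fubini_G m1 F = (fun y => \int[m1]_(x in D1) (f x y)%:E) \_ D2.
  apply/funext => y; rewrite /fubini_G patchE; case: ifPn => [/set_mem Dy|nDy].
    by rewrite F2// -integral_mkcond.
  by apply: integral0_eq => x _; rewrite /F patchE in_setX (negPf nDy) andbF.
split.
- apply: filterS (ae_integrable1 iF) => x intx Dx.
  by rewrite F1// in intx; apply/(iffRL (integrable_mkcond _ mD2)).
- by apply/(iffRL (integrable_mkcond _ mD1)); rewrite -E1; exact: integrable_fubini_F.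
- apply/(iffRL (measurable_restrictT _ mD2)); rewrite -E2.
  exact: (measurable_fubini_G iF).
- rewrite integral_mkcond -E1 [RHS]integral_mkcond -E2.
  by rewrite integral12_prod_meas1// integral21_prod_meas1.
Qed.

End FubiniRect.

Section Complexify.
Context d (T : measurableType d) (R : realType) (m : {measure set T -> \bar R}).
Variables (D : set T) (f : T -> R[i]) (g : T -> R).
Hypothesis fg : forall x, f x = (g x)%:C.

Lemma Cintegrable_real : m.-integrable D (EFin \o g) -> Cintegrable m D f.
Proof.
move=> ig; split.
- by under eq_fun do rewrite fg.
- under eq_fun do rewrite fg /=.
  exact: integrable0.
Qed.

Lemma Cintegral_real : Cintegral m D f = (\int[m]_(x in D) g x)%:C.
Proof.
rewrite /Cintegral; congr (_ +i* _).
- by apply: eq_Rintegral => x _; rewrite fg.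
- rewrite (@eq_Rintegral _ _ _ _ _ (cst 0)); first by rewrite /Rintegral integral0.
  by move=> x _; rewrite fg.
Qed.

End Complexify.

Lemma horner_bounded (R : realType) (p : {poly R}) :
  exists B, forall u, -1 <= u <= 1 -> `|p.[u]| <= B.
Proof.
exists (\sum_(i < size p) `|p`_i|) => u u1.
rewrite horner_coef (le_trans (ler_norm_sum _ _ _))//; apply: ler_sum => i _.
by rewrite normrM ler_piMr// normrX exprn_ile1// ler_norml.
Qed.

Section Biorthogonality.
Variables (R : realType) (k n n' : nat).
Let d := k.+2.
Let mu := @lebesgue_measure R.
Let lam := lebesgue_tuple R d.
Let M (u : R) (th : d.-tuple R) := Bspline d.-1 u (fun i => cos (nth 0 th i)).
Let w (th : d.-tuple R) := dirichlet_sum th n / (Ndn d n)%:R.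
Let h := hdn R d n'.

Let mbox : measurable (@torus_box R d) := @measurable_torus_box R d.

Let mI : measurable (`[-1, 1]%classic : set (measurableTypeR R)).
Proof. exact: measurable_itv. Qed.

Let mw : measurable_fun setT w.
Proof.
by apply: measurable_funM; [exact: measurable_dirichlet_sum|exact: measurable_cst].
Qed.

Let w_bounded : exists B, forall th, `|w th| <= B.
Proof.
exists (dirichlet_sum (nseq d 0) n / (Ndn d n)%:R) => th.
rewrite normrM [X in _ * X]ger0_norm ?invr_ge0// ler_wpM2r ?invr_ge0//.
by have := dirichlet_sum_le0 th n; rewrite size_tuple.
Qed.

Let int_Mw : (mu \x lam)%E.-integrable (`[-1, 1] `*` @torus_box R d)
  (fun p => (M p.1 p.2 * w p.2)%:E).
Proof.
apply: (@integrable_BsplineM R k (fun _ th => w th)).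
  exact: (measurableT_comp mw measurable_snd).
by have [B wB] := w_bounded; exists B => u th _; exact: wB.
Qed.

Let int_Mwh : (mu \x lam)%E.-integrable (`[-1, 1] `*` @torus_box R d)
  (fun p => (M p.1 p.2 * (w p.2 * h.[p.1]))%:E).
Proof.
apply: (@integrable_BsplineM R k (fun u th => w th * h.[u])).
  apply: measurable_funM; first exact: (measurableT_comp mw measurable_snd).
  exact: (measurableT_comp (measurable_poly h (A := setT)) measurable_fst).
have [B wB] := w_bounded; have [C hC] := horner_bounded h.
by exists (B * C) => u th u1; rewrite normrM ler_pM// hC.
Qed.

Lemma mdn_integrandE u (th : d.-tuple R) : mdn_integrand n u th = (M u th * w th)%:C.
Proof.
rewrite /mdn_integrand EdnE.
have -> : (Ndn d n)%:R = ((Ndn d n)%:R : R)%:C by rewrite rmorph_nat.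
by rewrite -fmorphV -!rmorphM.
Qed.

Lemma ae_Cintegrable_mdn_integrand :
  {ae mu, forall u, u \in `[-1, 1] ->
     Cintegrable lam (@torus_box R d) (@mdn_integrand R d n u)}.
Proof.
have [ae1 _ _ _] :=
  fubini_rect (f := fun (u : measurableTypeR R) th => M u th * w th) mI mbox int_Mw.
apply: filterS ae1 => u intu u1.
by apply: (Cintegrable_real (mdn_integrandE u)); exact: intu.
Qed.

Let G u := \int[lam]_(th in @torus_box R d) (M u th * w th).

Lemma mdnE u : mdn d n u = ((2 * pi) ^- d * G u)%:C.
Proof. by rewrite /mdn (Cintegral_real _ _ (mdn_integrandE u)) rmorphM. Qed.

Lemma integrable_Gh : mu.-integrable `[-1, 1] (fun u => (G u * h.[u])%:E).
Proof.
have [_ intG _ _] :=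
  fubini_rect (f := fun (u : measurableTypeR R) th => M u th * w th) mI mbox int_Mw.
have intG' := integrable_fine mI intG.
have [C hC] := horner_bounded h.
apply: eq_integrable (integrableMl mI intG' (measurable_poly h (A := _)) _) => //.
exists C; split=> [|K CK u /= hu]; first exact: num_real.
by apply: (le_trans _ (ltW CK)); apply: hC; move: hu; rewrite in_itv.
Qed.

(** After exchanging the integrals, the inner one is the divided difference of
    [hdn_primitive], that is the Dirichlet sum of index [n']. *)
Lemma integral_Gh : (\int[mu]_(u in `[(-1)%R, 1%R]) (G u * h.[u])%:E =
  (if n == n' then (2 * pi) ^+ d else 0)%:E)%E.
Proof.
have [ae1 _ _ _] :=
  fubini_rect (f := fun (u : measurableTypeR R) th => M u th * w th) mI mbox int_Mw.
have [_ int12 mG F] := fubini_rect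
  (f := fun (u : measurableTypeR R) th => M u th * (w th * h.[u])) mI mbox int_Mwh.
transitivity (\int[mu]_(u in `[(-1)%R, 1%R]) \int[lam]_(th in @torus_box R d)
    (M u th * (w th * h.[u]))%:E)%E.
  apply: ae_eq_integral => //.
  - exact: measurable_int integrable_Gh.
  - exact: measurable_int int12.
  apply: filterS ae1 => u intu u1; have {}intu := intu u1.
  under eq_integral do rewrite mulrA EFinM.
  by rewrite integralZr// EFinM /G /Rintegral fineK//; exact: integrable_fin_num.
rewrite F.
transitivity (\int[lam]_(th in @torus_box R d)
    ((Ndn d n)%:R^-1%:E * (dirichlet_sum th n * dirichlet_sum th n')%:E))%E.
  apply: ae_eq_integral => //.
  - apply: measurable_funeM; exact: measurable_int (integrable_dirichlet_sumM R d n n').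
  apply: filterS (@ae_uniq_map_cos R d) => th uth hth; have {}uth := uth hth.
  under eq_integral => u _ do rewrite mulrCA EFinM.
  have int1 : mu.-integrable `[-1, 1] (fun u => (M u th * h.[u])%:E).
    exact: integrable_Bspline_section.
  rewrite integralZl// /h -derivn_hdn_primitive// integral_Bspline//.
  have := lagrange_dd_hdn_primitive n' uth; rewrite size_tuple => ->.
    by rewrite -!EFinM /w; congr (_%:E); ring.
  by rewrite -size_eq0 size_tuple.
rewrite integralZl//; last exact: integrable_dirichlet_sumM.
rewrite integral_dirichlet_sumM -EFinM; congr (_%:E).
case: eqP => _; last by rewrite mulr0.
rewrite -NdnE mulrCA mulVf ?mulr1// pnatr_eq0 -lt0n.
exact: Ndn_gt0.
Qed.

End Biorthogonality.

Theorem theorem3p3 (R : realType) (d : nat) (hd : (2 <= d)%N) (n n' : nat) :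
  [/\ {ae @lebesgue_measure R, forall u, u \in `[-1, 1] ->
        Cintegrable (lebesgue_tuple R d) (@torus_box R d) (@mdn_integrand R d n u)},
      Cintegrable (@lebesgue_measure R) `[-1, 1]
        (fun u => mdn d n u * (hdn R d n').[u]%:C) &
      Cintegral (@lebesgue_measure R) `[-1, 1]
        (fun u => mdn d n u * (hdn R d n').[u]%:C) = (n == n')%:R].
Proof.
case: d hd => [|[|k]]// _.
pose G u := \int[lebesgue_tuple R k.+2]_(th in @torus_box R k.+2)
  (Bspline k.+1 u (fun i => cos (nth 0 th i)) *
   (dirichlet_sum th n / (Ndn k.+2 n)%:R)).
pose c : R := (2 * pi) ^- k.+2.
have E u : mdn k.+2 n u * (hdn R k.+2 n').[u]%:C =
    (c * (G u * (hdn R k.+2 n').[u]))%:C.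
  by rewrite mdnE -rmorphM mulrA.
have mI : measurable (`[-1, 1]%classic : set (measurableTypeR R)).
  exact: measurable_itv.
have int := integrable_Gh R k n n'.
split.
- exact: ae_Cintegrable_mdn_integrand.
- apply: (@Cintegrable_real _ (measurableTypeR R) R (@lebesgue_measure R) _ _ _ E).
  exact: (integrableZl mI c int).
- rewrite (@Cintegral_real _ (measurableTypeR R) R (@lebesgue_measure R) _ _ _ E).
  rewrite RintegralZl//.
  rewrite /Rintegral integral_Gh/=.
  case: eqP => _; last by rewrite mulr0.
  by rewrite mulVf// expf_neq0// mulf_neq0// gt_eqF// pi_gt0.
Qed.
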